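(* Choose $t \in [0,1]$, and assume that $\alpha$ is power-multiplicative (resp.\ multiplicative). (a) The function $H(\alpha,\pi,t)$ is a power-multiplicative (resp.\ multiplicative) seminorm on $W(R)$ bounded by $\lambda(\alpha)$. (b) Assume that $R = \widehat{R}$. For any stable presentation $x_0,x_1,\dots$ of $x \in W(R)$, $H(\alpha,\pi,t)(x) = \max_i \{(t/p)^i \lambda(\alpha)(x_i)\}$. (c) For $t \in [0, p\alpha(\overline{\pi_0})]$ with $p\alpha(\overline{\pi_0}) > 0$ and $c \in [1, 1 - \log_p (p\alpha(\overline{\pi_0}))]$, $H(\alpha,\pi,t) = H(\alpha^{1/c}, \pi, p(t/p)^{1/c})^c$. (d) For $t \in [p\alpha(\overline{\pi_0}),1]$ with $t>0$, we have $H(\alpha,\pi,t) = \lambda(\alpha^{1/c})^c$ for $c = 1 - \log_p t$. In particular, $H(\alpha, \pi,1) = \lambda(\alpha)$. (For $t=0$, the same conclusion holds by interpreting $\lambda(\alpha^{1/c})^c$ for $c = +\infty$ as the restriction of $\alpha$ along $W(R) \to R$.)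
   Context: Let $p$ be a prime, $R$ a perfect $\mathbb{F}_p$-algebra, $W(R)$ its ring of $p$-typical Witt vectors with Teichmüller map $[\cdot]: R \to W(R)$; every $x \in W(R)$ is uniquely $\sum_{i\ge0} p^i[\overline{x_i}]$ with $\overline{x_i} \in R$. Equip $R$ with a power-multiplicative seminorm $\alpha$ bounded by the trivial norm, and let $\widehat{R}$ be the separated completion of $R$ for $\alpha$. For such $\alpha$, $\lambda(\alpha)$ is the seminorm on $W(R)$ given by $\lambda(\alpha)(\sum_i p^i[\overline{x_i}]) = \max_i \{p^{-i}\alpha(\overline{x_i})\}$ (power-multiplicative, resp. multiplicative, when $\alpha$ is). Fix $\pi = \sum_{i\ge0} p^i [\overline{\pi_i}] \in W(R)$ with $\alpha(\overline{\pi_0}) \leq p^{-1}$ and $\overline{\pi_1}$ a unit in $R$. For $t \in [0,1]$, $H(\alpha,\pi,t)$ is the quotient seminorm on $W(R)[T]/(T-\pi) \cong W(R)$ induced by the $(t/p)$-Gauss extension of $\lambda(\alpha)$ to $W(R)[T]$ (the $r$-Gauss extension being $|\sum_i x_i T^i|_r = \max_i |x_i| r^i$). An element $x = \sum_i p^i[\overline{x_i}]$ is stable ($\alpha$-stable) if either $\alpha(\overline{x_i}) = 0$ for all $i$, or $\alpha(\overline{x_0}) > p^{-i}\alpha(\overline{x_i})$ for all $i>0$. When $R=\widehat{R}$, a presentation of $x \in W(R)$ is a sequence $x_0,x_1,\dots \in W(R)$ with $x = \sum_i x_i\pi^i$ (convergent since $W(R)$ is $(p,[\overline{\pi_0}])$-adically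 complete); it is stable if each $x_i$ is stable. Every element admits a stable presentation when $R = \widehat{R}$. *)

(* Defs.v *)
From HB Require Import structures.
From mathcomp Require Import all_boot all_order all_algebra.
From mathcomp Require Import finmap monalg.
From mathcomp Require Import boolp classical_sets reals exp.
Set Implicit Arguments. Unset Strict Implicit. Unset Printing Implicit Defensive.
Import Order.TTheory GRing.Theory Num.Theory.
Local Open Scope classical_set_scope.
Local Open Scope ring_scope.

(* Integer polynomials in the variables X_{j,i}, indexed by pairs (j, i). *)
Definition wvar : choiceType := (nat * nat)%type.
Definition mzpoly : comNzRingType := {malg int[cmonom wvar]}.

Definition mzvar (i : wvar) : mzpoly := mkmalgU (ucm i) 1.

Section Eval.
Variables (A : comNzRingType) (v : wvar -> A).

Definition monev (m : cmonom wvar) : A := \prod_(i <- finsupp m) v i ^+ m i.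

Lemma monevEw (m : cmonom wvar) (d : {fset wvar}) : (finsupp m `<=` d)%fset ->
  monev m = \prod_(i <- d) v i ^+ m i.
Proof.
move=> le; rewrite /monev (big_fset_incl _ le) //.
by move=> i _; rewrite -cmE_neq0 negbK => /eqP->.
Qed.

Lemma monev_mmorphism : mmorphism monev.
Proof.
split=> [m1 m2|]; last by rewrite /monev mdom1 big_seq_fset0.
rewrite /monev mdomD.
rewrite -/(monev m1) -/(monev m2).
rewrite (monevEw (fsubsetUl _ (finsupp m2))) (monevEw (fsubsetUr (finsupp m1) _)).
by rewrite -big_split /=; apply/eq_bigr => i _; rewrite cmM exprD.
Qed.

HB.instance Definition _ := isMultiplicative.Build _ _ monev monev_mmorphism.

Definition mzev (f : mzpoly) : A := mmap intr monev f.

HB.instance Definition _ := GRing.RMorphism.copy mzev (mmap intr monev).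

Lemma mzev_var i : mzev (mzvar i) = v i.
Proof.
rewrite /mzev /mzvar mmapU /= mulr1z mul1r /monev mdomU big_seq_fset1.
by rewrite cmUU.
Qed.
End Eval.

Lemma mkmalgUM (m1 m2 : cmonom wvar) :
  mkmalgU (mmul m1 m2) 1 = mkmalgU m1 1 * mkmalgU m2 1 :> mzpoly.
Proof. by rewrite [RHS]malgM_def fgmulUU mulr1. Qed.

Lemma mzpoly_ind (P : mzpoly -> Prop) :
  P 1 -> (forall f, P f -> P (- f)) ->
  (forall f g, P f -> P g -> P (f + g)) ->
  (forall f g, P f -> P g -> P (f * g)) ->
  (forall i, P (mzvar i)) -> forall f, P f.
Proof.
move=> P1 PN PD PM PX.
have P0 : P 0 by rewrite -(subrr 1); apply: PD => //; apply: PN.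
have Pn n : P n%:R.
  by elim: n => [//|n IH]; rewrite -addn1 natrD; apply: PD.
have Pz (z : int) : P z%:~R.
  by case: (intP z) => [|n|n]; rewrite ?rmorphN //; [exact: Pn|apply: PN; exact: Pn].
have Pm n : forall m : cmonom wvar, mdeg m = n -> P (mkmalgU m 1).
  elim: n => [|n IH] m.
    by move=> /mdeg_eq0I ->.
  move=> dm.
  have /existsNP [i] : ~ forall i, m i = 0%N.
    move=> m0; move: dm; rewrite mdegE big1 // => i _; exact: m0.
  move/eqP => mi.
  have mE : m = mmul (ucm i) (divcm m (ucm i)).
    apply/eqP/cmP => j; rewrite cmM divcmE ucmE.
    by case: eqVneq => [<-|_]; [rewrite subnKC // lt0n|rewrite subn0].
  rewrite mE mkmalgUM; apply: PM; first exact: PX.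
  by apply: IH; apply/eqP; rewrite -eqSS -dm {2}mE mdegM mdegU.
have Pg (c : int) m : P (mkmalgU m c).
  have -> : mkmalgU m c = c%:~R * mkmalgU m 1 :> mzpoly.
    by rewrite mulrzl -raddfMz /= intz.
  by apply: PM; [exact: Pz|exact: (Pm _ _ erefl)].
move=> f; rewrite (monalgE f).
elim: (enum_fset (msupp f)) => [|m s IH]; first by rewrite big_nil; exact: P0.
by rewrite big_cons; apply: PD; [exact: Pg|exact: IH].
Qed.

Lemma mzpoly_torsion_free (m : nat) (f : mzpoly) : (0 < m)%N -> m%:R * f = 0 -> f = 0.
Proof.
move=> m0; rewrite mulr_natl => /(congr1 (fun h : {malg int[_]} => mcoeff ^~ h)) E.
apply/malgP => k; have := congr1 (fun h => h k) E.
rewrite mcoeffMn mcoeff0 => /eqP; rewrite mulrn_eq0 eqn0Ngt m0 /=.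
by move/eqP.
Qed.

(* [mzpoly] is packaged with its universal property and locked, so that
   unification never unfolds the construction of the polynomial ring. *)
Record zpoly_ring := ZPolyRing {
  zpr :> comNzRingType;
  zpr_var : wvar -> zpr;
  zpr_ev : forall A : comNzRingType, (wvar -> A) -> {rmorphism zpr -> A};
  zpr_ev_var : forall (A : comNzRingType) (v : wvar -> A) i,
    zpr_ev v (zpr_var i) = v i;
  zpr_ind : forall P : zpr -> Prop,
    P 1 -> (forall f, P f -> P (- f)) ->
    (forall f g, P f -> P g -> P (f + g)) ->
    (forall f g, P f -> P g -> P (f * g)) ->
    (forall i, P (zpr_var i)) -> forall f, P f;
  zpr_torsion_free : forall (m : nat) (f : zpr), (0 < m)%N -> m%:R * f = 0 -> f = 0
}.

Fact zpoly_key : unit. Proof. by []. Qed.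
Definition zpoly : zpoly_ring := locked_with zpoly_key
  (@ZPolyRing mzpoly mzvar (fun A v => mzev v : {rmorphism mzpoly -> A})
     mzev_var mzpoly_ind mzpoly_torsion_free).

Definition zvar : wvar -> zpoly := @zpr_var zpoly.
Definition zev (A : comNzRingType) (v : wvar -> A) : {rmorphism zpoly -> A} :=
  zpr_ev zpoly v.
Definition zpoly_torsion_free := @zpr_torsion_free zpoly.

Lemma zev_var (A : comNzRingType) (v : wvar -> A) i : zev v (zvar i) = v i.
Proof. exact: zpr_ev_var. Qed.

Lemma zpoly_ind (P : zpoly -> Prop) :
  P 1 -> (forall f, P f -> P (- f)) ->
  (forall f g, P f -> P g -> P (f + g)) ->
  (forall f g, P f -> P g -> P (f * g)) ->
  (forall i, P (zvar i)) -> forall f, P f.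
Proof. exact: zpr_ind. Qed.

Lemma zev_unique (A : comNzRingType) (f g : {rmorphism zpoly -> A}) :
  (forall i, f (zvar i) = g (zvar i)) -> f =1 g.
Proof.
move=> fg; elim/zpoly_ind => [|h IH|h k IHh IHk|h k IHh IHk|//].
- by rewrite !rmorph1.
- by rewrite !rmorphN IH.
- by rewrite !rmorphD IHh IHk.
- by rewrite !rmorphM IHh IHk.
Qed.

Lemma zev_comp (A B : comNzRingType) (f : {rmorphism A -> B}) (v : wvar -> A) h :
  f (zev v h) = zev (f \o v) h.
Proof.
pose F : {rmorphism zpoly -> B} := f \o zev v.
apply: (zev_unique (f := F)) => i.
by rewrite /F /= !zev_var.
Qed.

Lemma zevD (A : comNzRingType) (v : wvar -> A) f g : zev v (f + g) = zev v f + zev v g.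
Proof. exact: (rmorphD (zev v)). Qed.

Lemma zevM (A : comNzRingType) (v : wvar -> A) f g : zev v (f * g) = zev v f * zev v g.
Proof. exact: (rmorphM (zev v)). Qed.

Lemma zevN (A : comNzRingType) (v : wvar -> A) f : zev v (- f) = - zev v f.
Proof. exact: (rmorphN (zev v)). Qed.

Section Cong.
Variable A : comNzRingType.
Implicit Types a b c d m : A.

Definition eqi m a b := exists c, a - b = m * c.

Lemma eqi_refl m a : eqi m a a.
Proof. by exists 0; rewrite subrr mulr0. Qed.

Lemma eqi_sym m a b : eqi m a b -> eqi m b a.
Proof. by case=> c E; exists (- c); rewrite mulrN -E opprB. Qed.

Lemma eqi_trans m a b c : eqi m a b -> eqi m b c -> eqi m a c.
Proof.
by case=> d E [e F]; exists (d + e); rewrite mulrDr -E -F addrA subrK.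
Qed.

Lemma eqiD m a b c d : eqi m a b -> eqi m c d -> eqi m (a + c) (b + d).
Proof.
by case=> x E [y F]; exists (x + y); rewrite mulrDr -E -F opprD addrACA.
Qed.

Lemma eqiN m a b : eqi m a b -> eqi m (- a) (- b).
Proof. by case=> x E; exists (- x); rewrite mulrN -E opprD. Qed.

Lemma eqiM m a b c d : eqi m a b -> eqi m c d -> eqi m (a * c) (b * d).
Proof.
case=> x E [y F]; exists (x * c + b * y).
rewrite mulrDr mulrA -E mulrCA -F mulrBl mulrBr.
by rewrite addrA subrK.
Qed.

Lemma eqiX m a b n : eqi m a b -> eqi m (a ^+ n) (b ^+ n).
Proof.
move=> ab; elim: n => [|n IH]; first by rewrite !expr0; exact: eqi_refl.
by rewrite !exprS; exact: eqiM.
Qed.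

Lemma eqi_sum m n (F G : nat -> A) : (forall i, (i < n)%N -> eqi m (F i) (G i)) ->
  eqi m (\sum_(i < n) F i) (\sum_(i < n) G i).
Proof.
elim: n => [|n IH] h; first by rewrite !big_ord0; exact: eqi_refl.
rewrite !big_ord_recr /=; apply: eqiD; last exact: h.
by apply: IH => i /ltnW; exact: h.
Qed.

Lemma eqiMl m c a b : eqi m a b -> eqi (c * m) (c * a) (c * b).
Proof. by case=> x E; exists x; rewrite -mulrBr E mulrA. Qed.

Lemma eqi_exprp (p : nat) k a b :
  eqi (p%:R ^+ k.+1) a b -> eqi (p%:R ^+ k.+2) (a ^+ p) (b ^+ p).
Proof.
move=> ab; case: (ab) => x E.
have [y F] : eqi p%:R (\sum_(i < p) a ^+ (p.-1 - i) * b ^+ i) 0.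
  apply: (@eqi_trans _ _ (\sum_(i < p) b ^+ p.-1)); last first.
    rewrite sumr_const card_ord; exists (b ^+ p.-1).
    by rewrite subr0 mulr_natl.
  pose G (i : nat) := b ^+ p.-1.
  apply: (@eqi_sum _ _ (fun i => a ^+ (p.-1 - i) * b ^+ i) G) => i ip.
  have -> : G i = b ^+ (p.-1 - i) * b ^+ i.
    by rewrite -exprD subnK //; case: (p) ip.
  apply: eqiM; last exact: eqi_refl.
  by apply: eqiX; exists (p%:R ^+ k * x); rewrite E mulrA -exprS.
exists (x * y); rewrite subrXX E.
move: F; rewrite subr0 => ->.
by rewrite [LHS]mulrACA -exprSr.
Qed.

Lemma eqi_exppn (p : nat) k a b :
  eqi p%:R a b -> eqi (p%:R ^+ k.+1) (a ^+ (p ^ k)) (b ^+ (p ^ k)).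
Proof.
move=> ab; elim: k => [|k IH]; first by rewrite expn0 !expr1.
by rewrite expnSr !exprM; exact: eqi_exprp.
Qed.

End Cong.

Lemma addrBK (A : comNzRingType) (a b : A) : a + (b - a) = b.
Proof. by rewrite addrC subrK. Qed.

Section Ghost.
Variables (p : nat) (A : comNzRingType).
Implicit Types x y : nat -> A.

Definition ghost (n : nat) (x : nat -> A) : A :=
  \sum_(i < n.+1) p%:R ^+ i * x i ^+ (p ^ (n - i)).

Definition ghost_low (n : nat) x : A :=
  \sum_(i < n) p%:R ^+ i * x i ^+ (p ^ (n - i)).

Lemma ghostE n x : ghost n x = ghost_low n x + p%:R ^+ n * x n.
Proof. by rewrite /ghost big_ord_recr /= subnn expn0 expr1. Qed.

Lemma eqi_ghost_ghost_low n x : eqi (p%:R ^+ n) (ghost n x) (ghost_low n x).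
Proof. by rewrite ghostE; exists (x n); rewrite [_ + _ * _]addrC addrK. Qed.

Lemma eq_ghost_low n x y : (forall i, (i < n)%N -> x i = y i) ->
  ghost_low n x = ghost_low n y.
Proof. by move=> xy; apply: eq_bigr => i _; rewrite xy. Qed.

Lemma eq_ghost n x y : (forall i, (i <= n)%N -> x i = y i) ->
  ghost n x = ghost n y.
Proof. by move=> xy; apply: eq_bigr => i _; rewrite xy // -ltnS. Qed.

Lemma ghost_lowS n x :
  ghost_low n.+1 x = ghost n (fun i => x i ^+ p).
Proof.
apply: eq_bigr => i _; have := ltn_ord i; rewrite ltnS => le.
by rewrite -exprM -expnS subSn.
Qed.

Lemma eqi_ghost_low n x y : (forall i, (i < n)%N -> eqi p%:R (x i) (y i)) ->
  eqi (p%:R ^+ n.+1) (ghost_low n x) (ghost_low n y).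
Proof.
move=> xy.
apply: (@eqi_sum _ _ _ (fun i => p%:R ^+ i * x i ^+ (p ^ (n - i)))
                       (fun i => p%:R ^+ i * y i ^+ (p ^ (n - i)))) => i ltin.
rewrite -[n.+1](@subnKC i) ?exprD; last by rewrite ltnW // ltnW.
by apply: eqiMl; rewrite subSn ?(ltnW ltin) //; apply: eqi_exppn; exact: xy.
Qed.

End Ghost.

Lemma rmorph_ghost p (A B : comNzRingType) (f : {rmorphism A -> B}) n (x : nat -> A) :
  f (ghost p n x) = ghost p n (f \o x).
Proof.
rewrite /ghost rmorph_sum; apply: eq_bigr => i _.
by rewrite rmorphM !rmorphXn rmorph_nat.
Qed.

Lemma zev_ghost p (A : comNzRingType) (v : wvar -> A) n (x : nat -> zpoly) :
  zev v (ghost p n x) = ghost p n (zev v \o x).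
Proof. exact: (rmorph_ghost p (zev v)). Qed.

Section Dwork.
Variables (p : nat) (hp : prime p).

Definition zfrob : zpoly -> zpoly := zev (fun i => zvar i ^+ p).
HB.instance Definition _ := GRing.RMorphism.on zfrob.

Lemma zpolyp_inj n : injective (fun f : zpoly => p%:R ^+ n * f).
Proof.
move=> f g /= /eqP; rewrite -subr_eq0 -mulrBr -natrX => /eqP /zpoly_torsion_free.
by rewrite expn_gt0 prime_gt0 // => /(_ isT) /eqP; rewrite subr_eq0 => /eqP.
Qed.

Lemma eqi_exprpD (A : comNzRingType) (a b : A) :
  eqi p%:R ((a + b) ^+ p) (a ^+ p + b ^+ p).
Proof.
rewrite exprDn; case: p hp => [//|q] q1.
rewrite big_ord_recl big_ord_recr /= bin0 binn subn0 subnn !expr0 !mulr1n mulr1 mul1r.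
rewrite addrA addrAC.
have [c ->] : exists c, \sum_(i < q) a ^+ (q.+1 - bump 0 i) * b ^+ bump 0 i *+ 'C(q.+1, bump 0 i)
    = q.+1%:R * c.
  apply: (big_ind (fun s => exists c, s = q.+1%:R * c)) => [|_ _ [x ->] [y ->]|i _].
  - by exists 0; rewrite mulr0.
  - by exists (x + y); rewrite mulrDr.
  have /dvdnP[k ->] : (q.+1 %| 'C(q.+1, bump 0 i))%N.
    by apply: prime_dvd_bin => //; rewrite /bump /= add1n ltnS.
  by exists (a ^+ (q.+1 - bump 0 i) * b ^+ bump 0 i *+ k); rewrite mulr_natl mulrnA.
by exists c; rewrite (_ : bump 0 q = q.+1) // [a ^+ q.+1 + _ + _]addrC addrK.
Qed.

Lemma eqi_exprpN (A : comNzRingType) (a : A) : eqi p%:R ((- a) ^+ p) (- a ^+ p).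
Proof.
have [p2|o] := even_prime hp.
  by rewrite p2; exists (a ^+ 2); rewrite sqrrN opprK mulr_natl mulr2n.
by rewrite exprNn -signr_odd o expr1 mulN1r; exact: eqi_refl.
Qed.

Lemma zfrob_eqi f : eqi p%:R (zfrob f) (f ^+ p).
Proof.
elim/zpoly_ind: f => [|f IH|f g IHf IHg|f g IHf IHg|i].
- by rewrite rmorph1 expr1n; exact: eqi_refl.
- rewrite rmorphN; apply: eqi_trans _ (eqi_sym (eqi_exprpN _)).
  exact: (eqiN IH).
- rewrite rmorphD; apply: eqi_trans _ (eqi_sym (eqi_exprpD _ _)).
  exact: (eqiD IHf IHg).
- by rewrite rmorphM exprMn; exact: (eqiM IHf IHg).
- by rewrite /zfrob zev_var; exact: eqi_refl.
Qed.

Lemma zfrob_ghost n (x : nat -> zpoly) :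
  eqi (p%:R ^+ n.+1) (zfrob (ghost p n x)) (ghost p n.+1 x).
Proof.
rewrite rmorph_ghost ghostE [ghost p n.+1 x]ghostE ghost_lowS.
apply: (@eqi_trans _ _ _ (ghost p n (fun i => x i ^+ p))); last first.
  by exists (- x n.+1); rewrite opprD addNKr mulrN.
rewrite [ghost p n _]ghostE; apply: eqiD.
  by apply: eqi_ghost_low => i _; exact: zfrob_eqi.
by rewrite exprSr; apply: eqiMl; exact: zfrob_eqi.
Qed.

(* Dwork's criterion: these congruences make (w n)_n the ghost components of
   a sequence of integer polynomials, unique by [ghost_inj_lt]. *)
Definition dwork (w : nat -> zpoly) :=
  forall n, eqi (p%:R ^+ n.+1) (zfrob (w n)) (w n.+1).

Lemma ghost_inj_lt m (x y : nat -> zpoly) :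
  (forall n, (n < m)%N -> ghost p n x = ghost p n y) ->
  forall i, (i < m)%N -> x i = y i.
Proof.
move=> xy i; elim/ltn_ind: i => i IH im.
have := xy _ im; rewrite !ghostE (@eq_ghost_low _ _ _ x y) => [/addrI/zpolyp_inj//|].
by move=> j ji; apply: IH => //; exact: ltn_trans ji im.
Qed.

Lemma dwork_exists w : dwork w -> exists s, forall n, ghost p n s = w n.
Proof.
move=> dw.
have ex m : exists s, forall n, (n < m)%N -> ghost p n s = w n.
  elim: m => [|m [s IH]]; first by exists (fun=> 0).
  have [c E] : eqi (p%:R ^+ m) (w m) (ghost_low p m s).
    case: m IH => [|m] IH; first by exists (w 0%N - ghost_low p 0 s); rewrite mul1r.
    apply: eqi_trans (eqi_sym (dw m)) _.
    have E := zfrob_ghost m s; rewrite (IH m (ltnSn m)) in E.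
    apply: (eqi_trans E).
    exact: eqi_ghost_ghost_low.
  pose s' i := if i == m then c else s i.
  have s'm : s' m = c by rewrite /s' eqxx.
  have s'lt i : (i < m)%N -> s' i = s i by move=> im; rewrite /s' ltn_eqF.
  exists s' => n; rewrite ltnS leq_eqVlt => /orP[/eqP->|nm].
    by rewrite ghostE s'm (eq_ghost_low p s'lt) -E; exact: addrBK.
  rewrite -(IH n nm); apply: eq_ghost => i im.
  by apply: s'lt; exact: leq_ltn_trans im nm.
have [s sP] := choice ex.
exists (fun n => s n.+1 n) => n.
rewrite -(sP n.+1 n (ltnSn n)); apply: eq_ghost => i im.
have E k : (k < i.+1)%N -> ghost p k (s i.+1) = ghost p k (s n.+1).
  by move=> ki; rewrite (sP _ _ ki) (sP n.+1 k (leq_trans ki _)).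
exact: (ghost_inj_lt E (ltnSn i)).
Qed.

(* the generic Witt vector (X_{j,0}, X_{j,1}, ...) *)
Definition wgen (j : nat) : nat -> zpoly := fun i => zvar (j, i).

Lemma dwork_add : dwork (fun n => ghost p n (wgen 0) + ghost p n (wgen 1)).
Proof. by move=> n; rewrite rmorphD; apply: eqiD; exact: zfrob_ghost. Qed.

Lemma dwork_mul : dwork (fun n => ghost p n (wgen 0) * ghost p n (wgen 1)).
Proof. by move=> n; rewrite rmorphM; apply: eqiM; exact: zfrob_ghost. Qed.

Lemma dwork_opp : dwork (fun n => - ghost p n (wgen 0)).
Proof. by move=> n; rewrite rmorphN; apply: eqiN; exact: zfrob_ghost. Qed.

(* The universal Witt vector polynomials S_n, P_n, I_n over the integers, in
   X_{0,*} and X_{1,*}; they are determined by the ghost identities below. *)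
Definition wadd_poly : nat -> zpoly := projT1 (cid (dwork_exists dwork_add)).
Definition wmul_poly : nat -> zpoly := projT1 (cid (dwork_exists dwork_mul)).
Definition wopp_poly : nat -> zpoly := projT1 (cid (dwork_exists dwork_opp)).

Lemma wadd_polyE n : ghost p n wadd_poly = ghost p n (wgen 0) + ghost p n (wgen 1).
Proof. exact: (projT2 (cid (dwork_exists dwork_add))). Qed.

Lemma wmul_polyE n : ghost p n wmul_poly = ghost p n (wgen 0) * ghost p n (wgen 1).
Proof. exact: (projT2 (cid (dwork_exists dwork_mul))). Qed.

Lemma wopp_polyE n : ghost p n wopp_poly = - ghost p n (wgen 0).
Proof. exact: (projT2 (cid (dwork_exists dwork_opp))). Qed.

End Dwork.

(* W(A) as the set of sequences in A; [wcoord] gives the Witt components, which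
   differ from the Teichmuller coordinates [tcoord] by iterated Frobenius. *)
Record witt (p : nat) (hp : prime p) (A : comNzRingType) := Witt { wcoord : nat -> A }.
Arguments Witt {p} hp {A} wcoord.

HB.instance Definition _ p hp A := gen_eqMixin (@witt p hp A).
HB.instance Definition _ p hp A := gen_choiceMixin (@witt p hp A).

Section WittOps.
Variables (p : nat) (hp : prime p).

Section Ops.
Variable A : comNzRingType.
Local Notation W := (witt hp A).
Implicit Types x y : W.

Definition wvals x y : wvar -> A :=
  fun i => if i.1 == 0%N then wcoord x i.2 else wcoord y i.2.

Definition wadd x y : W := Witt hp (fun n => zev (wvals x y) (wadd_poly hp n)).
Definition wmul x y : W := Witt hp (fun n => zev (wvals x y) (wmul_poly hp n)).
Definition wopp x : W := Witt hp (fun n => zev (wvals x x) (wopp_poly hp n)).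
Definition teich (a : A) : W := Witt hp (fun n => if n == 0%N then a else 0).

Lemma wittP x y : (forall n, wcoord x n = wcoord y n) -> x = y.
Proof. by case: x y => [x] [y] /= /funext ->. Qed.

Lemma wvals_gen0 x y : zev (wvals x y) \o wgen 0 = wcoord x.
Proof. by apply/funext => i; rewrite [LHS]zev_var. Qed.

Lemma wvals_gen1 x y : zev (wvals x y) \o wgen 1 = wcoord y.
Proof. by apply/funext => i; rewrite [LHS]zev_var. Qed.

Lemma ghost_zev v (s : nat -> zpoly) n :
  ghost p n (fun k => zev v (s k) : A) = zev v (ghost p n s).
Proof. by rewrite rmorph_ghost. Qed.

Lemma ghost_wadd x y n :
  ghost p n (wcoord (wadd x y)) = ghost p n (wcoord x) + ghost p n (wcoord y).
Proof.
rewrite [LHS](ghost_zev (wvals x y) (wadd_poly hp) n) wadd_polyE.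
rewrite zevD (zev_ghost p _ n (wgen 0)) (zev_ghost p _ n (wgen 1)).
by rewrite wvals_gen0 wvals_gen1.
Qed.

Lemma ghost_wmul x y n :
  ghost p n (wcoord (wmul x y)) = ghost p n (wcoord x) * ghost p n (wcoord y).
Proof.
rewrite [LHS](ghost_zev (wvals x y) (wmul_poly hp) n) wmul_polyE.
rewrite zevM (zev_ghost p _ n (wgen 0)) (zev_ghost p _ n (wgen 1)).
by rewrite wvals_gen0 wvals_gen1.
Qed.

Lemma ghost_wopp x n : ghost p n (wcoord (wopp x)) = - ghost p n (wcoord x).
Proof.
rewrite [LHS](ghost_zev (wvals x x) (wopp_poly hp) n) wopp_polyE.
rewrite zevN (zev_ghost p _ n (wgen 0)).
by rewrite wvals_gen0.
Qed.

Lemma ghost_teich a n : ghost p n (wcoord (teich a)) = a ^+ (p ^ n).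
Proof.
rewrite /ghost big_ord_recl /= expr0 mul1r subn0 big1 ?addr0 // => i _.
by rewrite expr0n expn_eq0 eqn0Ngt prime_gt0 //= mulr0.
Qed.

End Ops.

Definition wmap (A B : comNzRingType) (f : A -> B) (x : witt hp A) : witt hp B :=
  Witt hp (f \o wcoord x).

Section Map.
Variables (A B : comNzRingType) (f : {rmorphism A -> B}).

Lemma wvals_map (x y : witt hp A) : f \o wvals x y = wvals (wmap f x) (wmap f y).
Proof. by apply/funext => i; rewrite /wvals /=; case: eqP. Qed.

Lemma wmapD x y : wmap f (wadd x y) = wadd (wmap f x) (wmap f y).
Proof. by apply: wittP => n /=; rewrite zev_comp wvals_map. Qed.

Lemma wmapM x y : wmap f (wmul x y) = wmul (wmap f x) (wmap f y).
Proof. by apply: wittP => n /=; rewrite zev_comp wvals_map. Qed.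

Lemma wmapN x : wmap f (wopp x) = wopp (wmap f x).
Proof. by apply: wittP => n /=; rewrite zev_comp wvals_map. Qed.

Lemma wmap_teich a : wmap f (teich a) = teich (f a).
Proof. by apply: wittP => n /=; case: eqP; rewrite ?rmorph0. Qed.
End Map.

Lemma witt_ghost_inj (x y : witt hp zpoly) :
  (forall n, ghost p n (wcoord x) = ghost p n (wcoord y)) -> x = y.
Proof.
by move=> xy; apply: wittP => n; apply: (ghost_inj_lt hp (m := n.+1)).
Qed.

Lemma witt_generic (A : comNzRingType) (x y z : witt hp A) :
  exists (f : {rmorphism zpoly -> A}),
    [/\ x = wmap f (Witt hp (wgen 0)), y = wmap f (Witt hp (wgen 1))
      & z = wmap f (Witt hp (wgen 2))].
Proof.
pose v (i : wvar) := if i.1 == 0%N then wcoord x i.2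
                     else if i.1 == 1%N then wcoord y i.2 else wcoord z i.2.
by exists (zev v); split; apply: wittP => n /=; rewrite zev_var.
Qed.

Section Ring.
Variable A : comNzRingType.
Local Notation W := (witt hp A).

Definition wsimp := (ghost_wadd, ghost_wmul, ghost_wopp, ghost_teich).

Lemma waddA : associative (@wadd A).
Proof.
move=> x y z; have [f [-> -> ->]] := witt_generic x y z.
rewrite -!wmapD; congr wmap; apply: witt_ghost_inj => n.
by rewrite !wsimp addrA.
Qed.

Lemma waddC : commutative (@wadd A).
Proof.
move=> x y; have [f [-> -> _]] := witt_generic x y x.
rewrite -!wmapD; congr wmap; apply: witt_ghost_inj => n.
by rewrite !wsimp addrC.
Qed.

Lemma wadd0 : left_id (teich 0) (@wadd A).
Proof.
move=> x; have [f [-> _ _]] := witt_generic x x x.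
rewrite -(rmorph0 f) -wmap_teich -!wmapD; congr wmap; apply: witt_ghost_inj => n.
by rewrite !wsimp expr0n expn_eq0 eqn0Ngt prime_gt0 //= add0r.
Qed.

Lemma waddN : left_inverse (teich 0) (@wopp A) (@wadd A).
Proof.
move=> x; have [f [-> _ _]] := witt_generic x x x.
rewrite -(rmorph0 f) -wmap_teich -wmapN -!wmapD; congr wmap.
apply: witt_ghost_inj => n.
by rewrite !wsimp expr0n expn_eq0 eqn0Ngt prime_gt0 //= addNr.
Qed.

Lemma wmulA : associative (@wmul A).
Proof.
move=> x y z; have [f [-> -> ->]] := witt_generic x y z.
rewrite -!wmapM; congr wmap; apply: witt_ghost_inj => n.
by rewrite !wsimp mulrA.
Qed.

Lemma wmulC : commutative (@wmul A).
Proof.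
move=> x y; have [f [-> -> _]] := witt_generic x y x.
rewrite -!wmapM; congr wmap; apply: witt_ghost_inj => n.
by rewrite !wsimp mulrC.
Qed.

Lemma wmul1 : left_id (teich 1) (@wmul A).
Proof.
move=> x; have [f [-> _ _]] := witt_generic x x x.
rewrite -(rmorph1 f) -wmap_teich -!wmapM; congr wmap; apply: witt_ghost_inj => n.
by rewrite !wsimp expr1n mul1r.
Qed.

Lemma wmulDl : left_distributive (@wmul A) (@wadd A).
Proof.
move=> x y z; have [f [-> -> ->]] := witt_generic x y z.
rewrite -!(wmapM, wmapD); congr wmap; apply: witt_ghost_inj => n.
by rewrite !wsimp mulrDl.
Qed.

Lemma teich1_neq0 : teich 1 != teich 0 :> W.
Proof.
apply/eqP => /(congr1 (fun x => wcoord x 0%N)) /= /eqP; exact/negP/oner_neq0.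
Qed.

HB.instance Definition _ := GRing.isZmodule.Build W waddA waddC wadd0 waddN.
HB.instance Definition _ :=
  GRing.Zmodule_isComNzRing.Build W wmulA wmulC wmul1 wmulDl teich1_neq0.
End Ring.

Section StrictPRing.
Variable A : comNzRingType.
Local Notation W := (witt hp A).
Implicit Types x y z : W.

Definition wres x : A := wcoord x 0.

Lemma wresE x : wres x = ghost p 0 (wcoord x).
Proof. by rewrite /ghost big_ord1 expr0 mul1r expn0 expr1. Qed.

Lemma wres_is_additive : zmod_morphism wres.
Proof. by move=> x y; rewrite !wresE [_ - _]/(wadd x (wopp y)) !wsimp. Qed.

Lemma wres_is_multiplicative : monoid_morphism wres.
Proof.
by split=> [//|x y]; rewrite !wresE [_ * _]/(wmul x y) !wsimp.
Qed.

HB.instance Definition _ := GRing.isZmodMorphism.Build W A wres wres_is_additive.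
HB.instance Definition _ := GRing.isMonoidMorphism.Build W A wres wres_is_multiplicative.

Lemma wres_teich a : wres (teich a) = a.
Proof. by []. Qed.

End StrictPRing.

Definition wversch (A : comNzRingType) (x : witt hp A) : witt hp A :=
  Witt hp (fun n => if n is m.+1 then wcoord x m else 0).

Definition wfrobX (A : comNzRingType) (x : witt hp A) : witt hp A :=
  Witt hp (fun n => wcoord x n ^+ p).

Lemma ghost_wversch (A : comNzRingType) (x : witt hp A) n :
  ghost p n.+1 (wcoord (wversch x)) = p%:R * ghost p n (wcoord x).
Proof.
rewrite /ghost big_ord_recl /= expr0 mul1r expr0n expn_eq0 eqn0Ngt prime_gt0 //= add0r.
by rewrite mulr_sumr; apply: eq_bigr => i _; rewrite /bump /= add1n exprS mulrA subSS.
Qed.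

Lemma wmap_versch (A B : comNzRingType) (f : {rmorphism A -> B}) x :
  wmap f (wversch x) = wversch (wmap f x).
Proof. by apply: wittP => -[|n] //=; rewrite rmorph0. Qed.

Lemma ghost_teich_versch (A : comNzRingType) a (x : witt hp A) n :
  ghost p n (wcoord (wadd (teich a) (wversch x))) =
  ghost p n (fun i => if i is j.+1 then wcoord x j else a).
Proof.
rewrite ghost_wadd ghost_teich; case: n => [|n].
  by rewrite /ghost !big_ord1 !expr0 !mul1r !expn0 !expr1 addr0.
rewrite ghost_wversch [in RHS]/ghost big_ord_recl expr0 mul1r /= subn0; congr (_ + _).
by rewrite mulr_sumr; apply: eq_bigr => i _; rewrite /bump /= add1n exprS mulrA subSS.
Qed.

Lemma witt_decomp (A : comNzRingType) (x : witt hp A) :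
  x = teich (wres x) + wversch (Witt hp (fun n => wcoord x n.+1)).
Proof.
have [f [-> _ _]] := witt_generic x x x.
set g := Witt hp (wgen 0).
rewrite {1}(_ : g = wadd (teich (wres g)) (wversch (Witt hp (fun n => wcoord g n.+1)))).
  by rewrite wmapD wmap_teich wmap_versch.
apply: witt_ghost_inj => n; rewrite ghost_teich_versch.
by congr ghost; apply/funext => -[].
Qed.

Lemma wmapMn (A B : comNzRingType) (f : {rmorphism A -> B}) (x : witt hp A) n :
  wmap f (x *+ n) = wmap f x *+ n.
Proof.
elim: n => [|n IH]; first by rewrite !mulr0n [LHS]wmap_teich rmorph0.
by rewrite !mulrS -IH [LHS]wmapD.
Qed.

Lemma ghostMn (A : comNzRingType) (x : witt hp A) n m :
  ghost p m (wcoord (x *+ n)) = ghost p m (wcoord x) *+ n.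
Proof.
elim: n => [|n IH].
  by rewrite !mulr0n ghost_teich expr0n expn_eq0 eqn0Ngt prime_gt0.
by rewrite !mulrS -IH [LHS]ghost_wadd.
Qed.

Lemma eqi_ghost_inj (x y : nat -> zpoly) :
  (forall n, eqi (p%:R ^+ n.+1) (ghost p n x) (ghost p n y)) ->
  forall n, eqi p%:R (x n) (y n).
Proof.
move=> xy; elim/ltn_ind=> n IH.
have [c E] := xy n; have [d F] := eqi_ghost_low IH.
exists (c - d); apply: (zpolyp_inj hp (n := n)) => /=.
rewrite mulrA -exprSr !mulrBr -E -F !ghostE.
by rewrite opprD addrACA [X in _ = X - _]addrC addrK.
Qed.

Lemma witt_mulp (A : comNzRingType) (x : witt hp A) : p%:R = 0 :> A ->
  p%:R * x = wversch (wfrobX x).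
Proof.
move=> pA; rewrite mulr_natl.
have [f [-> _ _]] := witt_generic x x x.
set g := Witt hp (wgen 0).
have -> : wfrobX (wmap f g) = wmap f (wfrobX g).
  by apply: wittP => n /=; rewrite rmorphXn.
rewrite -wmapMn -wmap_versch; apply: wittP => n /=.
have [n'|c /eqP] := @eqi_ghost_inj (wcoord (g *+ p)) (wcoord (wversch (wfrobX g))) _ n.
  rewrite ghostMn; case: n' => [|n'].
    rewrite (_ : ghost p 0 (wcoord (wversch _)) = 0); last by rewrite -wresE.
    by exists (ghost p 0 (wcoord g)); rewrite subr0 expr1 mulr_natl.
  rewrite ghost_wversch [ghost p n'.+1 _]ghostE ghost_lowS -(mulr_natl (_ + _)).
  exists (wcoord g n'.+1); rewrite -mulrBr [_ + _ * _]addrC addrK.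
  by rewrite mulrA -exprS.
rewrite subr_eq => /eqP ->.
by rewrite rmorphD rmorphM rmorph_nat pA mul0r add0r.
Qed.

(* x = \sum_i p^i [a_i], the series converging p-adically *)
Definition teich_series (A : comNzRingType) (x : witt hp A) (a : nat -> A) :=
  forall n, exists z, x = \sum_(i < n) p%:R ^+ i * teich (a i) + p%:R ^+ n * z.

Section Perfect.
Variable A : comNzRingType.
Hypotheses (pA : p%:R = 0 :> A) (perfA : bijective (fun a : A => a ^+ p)).
Local Notation W := (witt hp A).

Lemma witt_mulp_inj : injective (fun x : W => p%:R * x).
Proof.
move=> x y /=; rewrite !witt_mulp // => /(congr1 (@wcoord _ _ _)) E.
by apply: wittP => n; apply: (bij_inj perfA); have := congr1 (fun h => h n.+1) E.
Qed.

Lemma witt_decomp_mulp (x : W) : exists y, x = teich (wres x) + p%:R * y.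
Proof.
case: (perfA) => g gK Kg; exists (Witt hp (fun n => g (wcoord x n.+1))).
rewrite witt_mulp // {1}[x]witt_decomp; congr (_ + wversch _).
by apply: wittP => n /=; rewrite Kg.
Qed.

Lemma teich_series_exists (x : W) : exists a, teich_series x a.
Proof.
have [d dP] := choice witt_decomp_mulp.
exists (fun i => wres (iter i d x)) => n; exists (iter n d x).
elim: n => [|n IH]; first by rewrite big_ord0 add0r mul1r.
rewrite big_ord_recr /= -addrA exprSr -mulrA -mulrDr -dP; exact: IH.
Qed.

Lemma teich_series_unique (x : W) a b : teich_series x a -> teich_series x b -> a = b.
Proof.
move=> xa xb; apply/funext => n.
elim/ltn_ind: n => n IH.
have [y ya] := xa n.+1; have [z zb] := xb n.+1.
have : p%:R ^+ n * (teich (a n) + p%:R * y) = p%:R ^+ n * (teich (b n) + p%:R * z).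
  rewrite !mulrDr !mulrA -exprSr.
  apply: (addrI (\sum_(i < n) p%:R ^+ i * teich (a i))).
  rewrite addrA -(big_ord_recr n (fun i => p%:R ^+ i * teich (a i))) -ya zb.
  rewrite big_ord_recr addrA; congr (_ + _ + _).
  by apply: eq_bigr => i _; rewrite IH.
have inj : injective (fun x : W => p%:R ^+ n * x).
  elim: (n) => [u v /=|m IHm u v /=]; first by rewrite !mul1r.
  by rewrite exprSr -!mulrA => /IHm /witt_mulp_inj.
move=> /inj /(congr1 (@wres A)).
by rewrite !rmorphD !rmorphM /= rmorph_nat pA !mul0r !addr0.
Qed.

End Perfect.

(* For A perfect of characteristic p the set is a singleton, by
   [teich_series_exists] and [teich_series_unique]. *)
Definition tcoord (A : comNzRingType) (x : witt hp A) : nat -> A :=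
  xget (fun=> 0) [set a | teich_series x a].

Lemma tcoordP (A : comNzRingType) (x : witt hp A) : p%:R = 0 :> A ->
  bijective (fun a : A => a ^+ p) -> teich_series x (tcoord x).
Proof.
move=> pA perfA; have [a xa] := teich_series_exists pA perfA x.
by rewrite /tcoord; case: xgetP => [_ _ //|/(_ a)].
Qed.

End WittOps.

Section Seminorms.
Variable K : realType.

Definition seminorm (V : zmodType) (alpha : V -> K) :=
  [/\ forall x, 0 <= alpha x, alpha 0 = 0 &
      forall x y, alpha (x - y) <= Num.max (alpha x) (alpha y)].

Definition submultiplicative_seminorm (A : comNzRingType) (alpha : A -> K) :=
  [/\ seminorm alpha, alpha 1 <= 1 &
      forall x y, alpha (x * y) <= alpha x * alpha y].

Definition power_multiplicative_seminorm (A : comNzRingType) (alpha : A -> K) :=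
  submultiplicative_seminorm alpha /\
  forall x n, (0 < n)%N -> alpha (x ^+ n) = alpha x ^+ n.

Definition multiplicative_seminorm (A : comNzRingType) (alpha : A -> K) :=
  [/\ seminorm alpha, alpha 1 = 1 &
      forall x y, alpha (x * y) = alpha x * alpha y].

Definition trivial_norm (A : comNzRingType) (x : A) : K := (x != 0)%:R.

Definition bounded_by (T : Type) (alpha beta : T -> K) :=
  forall x, alpha x <= beta x.

(* The canonical map from A to its separated completion is bijective. *)
Definition separated_complete (A : comNzRingType) (alpha : A -> K) :=
  (forall x, alpha x = 0 -> x = 0) /\
  (forall u : nat -> A,
     (forall e, 0 < e -> exists N, forall m n,
        (N <= m)%N -> (N <= n)%N -> alpha (u m - u n) < e) ->
     exists l, forall e, 0 < e -> exists N, forall n,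
        (N <= n)%N -> alpha (u n - l) < e).

Definition logb (b x : K) : K := ln x / ln b.

Definition fpow (T : Type) (alpha : T -> K) (r : K) : T -> K :=
  fun x => alpha x `^ r.

Definition is_max (u : nat -> K) (m : K) :=
  (exists i, u i = m) /\ forall i, u i <= m.

Definition gauss (A : comNzRingType) (beta : A -> K) (r : K) (f : {poly A}) : K :=
  \big[Num.max/0]_(i < size f) (beta f`_i * r ^+ i).

(* The infimum is over the coset of x modulo (T - a), where x in A is identified
   with its class in A[T]/(T - a). *)
Definition quotient_gauss (A : comNzRingType) (beta : A -> K) (r : K) (a x : A) : K :=
  inf [set gauss beta r f | f in
        [set f : {poly A} | exists g, f = x%:P + g * ('X - a%:P)]].

Lemma is_max_sup (u : nat -> K) m : is_max u m -> sup (range u) = m.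
Proof.
move=> [[i <-] um]; apply/eqP; rewrite eq_le; apply/andP; split.
  by apply: ge_sup; [exists (u i); exists i|move=> _ [j _ <-]].
by apply: ub_le_sup; [exists (u i) => _ [j _ <-]|exists i].
Qed.

Lemma is_max_exists (u : nat -> K) p : (1 < p)%N ->
  (forall i, 0 <= u i <= p%:R ^- i) -> exists m, is_max u m.
Proof.
move=> p1 hu.
have [[k uk]|u0] := pselect (exists k, 0 < u k); last first.
  exists (u 0%N); split=> [|i]; first by exists 0%N.
  have /andP[u00 _] := hu 0%N; apply: le_trans u00.
  by rewrite leNgt; apply/negP => ui; apply: u0; exists i.
have [N hN] : exists N, (u k)^-1 < N%:R.
  by exists (Num.bound (u k)^-1); apply: archi_boundP; rewrite invr_ge0 ltW.
have small i : (N <= i)%N -> u i <= u k.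
  move=> Ni; have /andP[_ /le_trans->//] := hu i.
  rewrite -[leRHS]invrK lef_pV2 ?posrE ?invr_gt0 ?exprn_gt0 ?ltr0n ?(ltn_trans _ p1) //.
  apply: le_trans (ltW hN) _; rewrite -natrX ler_nat.
  exact: leq_trans Ni (ltnW (ltn_expl _ p1)).
pose j := [arg max_(i > (ord0 : 'I_(maxn N k).+1)) u i]%O.
have jP (i : 'I_(maxn N k).+1) : u i <= u j.
  by rewrite /j; case: Order.TotalTheory.arg_maxP => // i0 _; apply.
exists (u j); split=> [|i]; first by exists j.
have [iN|iN] := ltnP i (maxn N k).+1; first exact: (jP (Ordinal iN)).
have kN : (k < (maxn N k).+1)%N by rewrite ltnS leq_maxr.
apply: le_trans (jP (Ordinal kN)); apply: small.
exact: leq_trans (leq_maxl N k) (ltnW iN).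
Qed.

Section WittSeminorms.
Variables (p : nat) (hp : prime p) (R : comNzRingType).
Local Notation W := (witt hp R).

(* The supremum is attained: see [lambda_is_max]. *)
Definition lambda (alpha : R -> K) (x : W) : K :=
  sup (range (fun i => p%:R ^- i * alpha (tcoord x i))).

Lemma lambda_is_max (alpha : R -> K) (x : W) :
  (forall a, 0 <= alpha a) -> bounded_by alpha (@trivial_norm R) ->
  is_max (fun i => p%:R ^- i * alpha (tcoord x i)) (lambda alpha x).
Proof.
move=> a0 a1.
suff [m hm] : exists m, is_max (fun i => p%:R ^- i * alpha (tcoord x i)) m.
  by rewrite /lambda (is_max_sup hm).
apply: (is_max_exists (prime_gt1 hp)) => i.
rewrite mulr_ge0 ?invr_ge0 ?exprn_ge0 //= ler_piMr ?invr_ge0 ?exprn_ge0 //.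
by apply: le_trans (a1 _) _; rewrite /trivial_norm; case: eqP.
Qed.

Definition Hseminorm (alpha : R -> K) (pi : W) (t : K) : W -> K :=
  quotient_gauss (lambda alpha) (t / p%:R) pi.

Definition stable (alpha : R -> K) (x : W) :=
  (forall i, alpha (tcoord x i) = 0) \/
  (forall i, (0 < i)%N -> p%:R ^- i * alpha (tcoord x i) < alpha (tcoord x 0)).

(* x lies in the n-th power of the ideal generated by a and b. *)
Definition in_ideal2_pow (a b : W) (n : nat) (x : W) :=
  exists c : 'I_n.+1 -> W, x = \sum_(i < n.+1) c i * (a ^+ i * b ^+ (n - i)).

(* x is the limit of the partial sums of the s i * pi^i for the topology defined
   by the powers of the ideal (p, [pi_0]). *)
Definition presentation (pi x : W) (s : nat -> W) :=
  forall n, exists N, forall m, (N <= m)%N ->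
    in_ideal2_pow p%:R (teich hp (tcoord pi 0)) n (x - \sum_(i < m) s i * pi ^+ i).

End WittSeminorms.
End Seminorms.

(* Main.v *)
Require Import Defs.
From HB Require Import structures.
From mathcomp Require Import all_boot all_order all_algebra.
From mathcomp Require Import ring.
From mathcomp Require Import boolp classical_sets reals exp.
Set Implicit Arguments. Unset Strict Implicit. Unset Printing Implicit Defensive.
Import Order.TTheory GRing.Theory Num.Theory.
Local Open Scope ring_scope.

(* The quotient seminorm H is the largest seminorm N on W(R) such that
   N (x pi^i) <= lambda(alpha)(x) (t/p)^i.  Since p equals (pi - [pi_0]) times a unit,
   H p <= max (t/p, alpha(pi_0)), so the Teichmuller expansion bounds H from above;
   comparing with the rescaled seminorms yields (c) and (d).

   For c in R[X] let T c in W(R)[X] have the coefficients [c_i].  No polynomial with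
   the value (T c)(pi) at pi has a smaller Gauss norm than c ([gauss_teich_le]), so
   H ((T c)(pi)) is the Gauss norm of c for alpha.  A polynomial of nearly minimal
   Gauss norm with value x is rewritten, by expanding its coefficients and
   substituting pi - [pi_0] for p up to the unit, as T c plus an error smaller by
   the factor 1/p.  Thus H x is the Gauss norm of such a c, and (a) reduces to Gauss
   norms on R[X].  A stable element differs from the Teichmuller lift of its residue by an
   element of smaller norm, which gives (b) for finite sums and then in the limit. *)

(** * Ultrametric seminorms on abelian groups and rings *)

Section SeminormTheory.
Variable K : realType.

Section Zmod.
Variables (V : zmodType) (beta : V -> K).
Hypothesis sb : seminorm beta.

Lemma seminorm_ge0 x : 0 <= beta x. Proof. by case: sb. Qed.

Lemma seminorm0 : beta 0 = 0. Proof. by case: sb. Qed.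

Lemma seminormB x y M : beta x <= M -> beta y <= M -> beta (x - y) <= M.
Proof. by case: sb => _ _ u xM yM; apply: le_trans (u x y) _; rewrite ge_max xM yM. Qed.

Lemma seminormN x : beta (- x) = beta x.
Proof.
have N y : beta (- y) <= beta y.
  by rewrite -(sub0r y); apply: seminormB => //; rewrite seminorm0 seminorm_ge0.
by apply/eqP; rewrite eq_le N -{1}(opprK x) N.
Qed.

Lemma seminormD x y M : beta x <= M -> beta y <= M -> beta (x + y) <= M.
Proof. by move=> xM yM; rewrite -(opprK y); apply: seminormB; rewrite ?seminormN. Qed.

Lemma seminormB_lt x y M : beta x < M -> beta y < M -> beta (x - y) < M.
Proof. by case: sb => _ _ u xM yM; apply: le_lt_trans (u x y) _; rewrite gt_max xM yM. Qed.

Lemma seminormD_lt x y M : beta x < M -> beta y < M -> beta (x + y) < M.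
Proof. by move=> xM yM; rewrite -(opprK y); apply: seminormB_lt; rewrite ?seminormN. Qed.

Lemma seminorm_sum (I : Type) (r : seq I) (P : pred I) (F : I -> V) M :
  0 <= M -> (forall i, P i -> beta (F i) <= M) -> beta (\sum_(i <- r | P i) F i) <= M.
Proof.
move=> M0 FM; apply: (big_ind (fun x => beta x <= M)) => //; first by rewrite seminorm0.
by move=> x y; apply: seminormD.
Qed.

(** The isosceles property: if x had smaller seminorm than y, then y = x - (x - y) would have
    seminorm less than its own. *)
Lemma seminorm_eq x y : beta (x - y) < beta y -> beta x = beta y.
Proof.
move=> xy; apply/eqP; rewrite eq_le; apply/andP; split.
  by rewrite -(subrK y x); apply: seminormD => //; exact: ltW.
rewrite leNgt; apply/negP => h.
suff : beta y < beta y by rewrite ltxx.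
by rewrite -{1}(subKr x y); apply: seminormB_lt; rewrite // -opprB seminormN.
Qed.

Lemma seminorm_near x y M : beta (x - y) < M -> beta x <= M -> beta y <= M.
Proof.
by move=> xy xM; rewrite -(subKr x y); apply: seminormB => //; rewrite ltW.
Qed.

End Zmod.

Section Ring.
Variables (A : comNzRingType) (beta : A -> K).
Hypothesis sb : submultiplicative_seminorm beta.

Let zb : seminorm beta. Proof. by case: sb. Qed.

Lemma submul_le x y M N : beta x <= M -> beta y <= N -> beta (x * y) <= M * N.
Proof.
case: sb => _ _ m xM yN; apply: le_trans (m x y) _.
by apply: ler_pM => //; exact: seminorm_ge0.
Qed.

Lemma submulX_le x M n : beta x <= M -> beta (x ^+ n) <= M ^+ n.
Proof.
move=> xM; elim: n => [|n IH]; first by rewrite !expr0; case: sb.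
by rewrite !exprS; apply: submul_le.
Qed.

Lemma submul_lt x y M N : beta x < M -> beta y <= N -> 0 < N -> beta (x * y) < M * N.
Proof.
case: sb => _ _ m xM yN N0; apply: le_lt_trans (m x y) _.
apply: (@le_lt_trans _ _ (beta x * N)); last by rewrite ltr_pM2r.
by apply: ler_wpM2l => //; exact: seminorm_ge0.
Qed.

(** The error is (x - x') y + (y - y') x', with x' bounded by [seminorm_near]. Leading parts can
    thus be multiplied with an error that stays strictly smaller. *)
Lemma submul_near x x' y y' M N : 0 < M -> 0 < N ->
  beta (x - x') < M -> beta x <= M -> beta (y - y') < N -> beta y <= N ->
  beta (x * y - x' * y') < M * N.
Proof.
move=> M0 N0 xx' xM yy' yN.
have -> : x * y - x' * y' = (x - x') * y + (y - y') * x'.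
  by rewrite !mulrBl (mulrC y) (mulrC y') addrA subrK.
apply: (seminormD_lt zb); first exact: submul_lt.
by rewrite (mulrC M); apply: submul_lt => //; exact: (seminorm_near zb) xx' xM.
Qed.

Lemma submulX_near x x' M n : 0 < M -> beta (x - x') < M -> beta x <= M ->
  beta (x ^+ n - x' ^+ n) < M ^+ n.
Proof.
move=> M0 xx' xM; elim: n => [|n IH].
  by rewrite !expr0 subrr (seminorm0 zb) ltr01.
by rewrite !exprS; apply: submul_near => //; rewrite ?exprn_gt0 //; apply: submulX_le.
Qed.

End Ring.
End SeminormTheory.

(** * Gauss extensions to polynomial rings *)

Section Gauss.
Variables (K : realType) (A : comNzRingType) (beta : A -> K) (r : K).
Hypotheses (sb : submultiplicative_seminorm beta) (r0 : 0 <= r).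
Implicit Types f g : {poly A}.
Local Notation gauss := (gauss beta r).

Let zb : seminorm beta. Proof. by case: sb. Qed.

Lemma gauss_ge0 f : 0 <= gauss f.
Proof. by rewrite /gauss; elim/big_rec: _ => // i x _ x0; rewrite le_max x0 orbT. Qed.

Lemma coef_gauss f i : beta f`_i * r ^+ i <= gauss f.
Proof.
have [fi|fi] := ltnP i (size f); last by rewrite nth_default // (seminorm0 zb) mul0r gauss_ge0.
exact: (le_bigmax _ (fun i : 'I_(size f) => beta f`_i * r ^+ i) (Ordinal fi)).
Qed.

Lemma gauss_le f M : 0 <= M -> (forall i, beta f`_i * r ^+ i <= M) -> gauss f <= M.
Proof. by move=> M0 h; apply: bigmax_le. Qed.

Lemma gauss_lt f M : 0 < M -> (forall i, beta f`_i * r ^+ i < M) -> gauss f < M.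
Proof. by move=> M0 h; apply: bigmax_lt. Qed.

Lemma gaussC a : gauss a%:P = beta a.
Proof.
apply/eqP; rewrite eq_le; apply/andP; split; last first.
  by have := coef_gauss a%:P 0; rewrite coefC eqxx expr0 mulr1.
apply: gauss_le => [|i]; first exact: (seminorm_ge0 zb).
rewrite coefC; case: eqP => [->|_]; first by rewrite mulr1.
by rewrite (seminorm0 zb) mul0r (seminorm_ge0 zb).
Qed.

Lemma gaussX : gauss 'X <= r.
Proof.
apply: gauss_le => // i; rewrite coefX; case: eqP => [->|_].
  by rewrite expr1 ler_piMl //; case: sb.
by rewrite (seminorm0 zb) mul0r.
Qed.

(** A positive Gauss norm is not the default value 0 of the empty maximum, so some coefficient
    reaches it. *)
Lemma gauss_attained f : 0 < gauss f -> exists n, beta f`_n * r ^+ n = gauss f.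
Proof.
move=> f0; apply/not_existsP => h.
suff : gauss f < gauss f by rewrite ltxx.
apply: gauss_lt => // i; rewrite lt_neqAle coef_gauss andbT.
by apply/eqP; exact: h.
Qed.

Lemma gauss_submul : submultiplicative_seminorm gauss.
Proof.
split=> [||f g].
- split=> [f||f g]; first exact: gauss_ge0.
    by rewrite -[0]/(0%:P) gaussC (seminorm0 zb).
  apply: gauss_le => [|i]; first by rewrite le_max gauss_ge0.
  rewrite coefB; case: zb => _ _ /(_ f`_i g`_i) u.
  apply: le_trans (ler_wpM2r (exprn_ge0 i r0) u) _.
  rewrite maxr_pMl ?exprn_ge0 // ge_max !le_max.
  by rewrite coef_gauss /= coef_gauss orbT.
- by rewrite -[1]/(1%:P) gaussC; case: sb.
apply: gauss_le => [|i]; first by rewrite mulr_ge0 ?gauss_ge0.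
(* The radius may be 0, so a vanishing power of r is set apart before dividing by it. *)
have [->|ri0] := eqVneq (r ^+ i) 0; first by rewrite mulr0 mulr_ge0 ?gauss_ge0.
rewrite -ler_pdivlMr ?lt_def ?ri0 ?exprn_ge0 // coefM.
apply: (seminorm_sum zb) => [|j _]; first by rewrite divr_ge0 ?mulr_ge0 ?gauss_ge0 ?exprn_ge0.
rewrite ler_pdivlMr ?lt_def ?ri0 ?exprn_ge0 //.
apply: le_trans (ler_wpM2r (exprn_ge0 i r0) (submul_le sb (lexx _) (lexx _))) _.
have -> : r ^+ i = r ^+ j * r ^+ (i - j) by rewrite -exprD subnKC // -ltnS.
rewrite mulrACA.
by apply: ler_pM; rewrite ?coef_gauss ?mulr_ge0 ?exprn_ge0 ?(seminorm_ge0 zb).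
Qed.

(* Among the terms of maximal weight take the one of largest degree, and drop
   the terms of higher degree. *)
Definition gauss_lead f n a := exists2 g : {poly A},
  (size g <= n.+1)%N /\ g`_n = a & gauss (f - g) < gauss f /\ beta a * r ^+ n = gauss f.

Let zg : seminorm gauss. Proof. by case: gauss_submul. Qed.

Lemma gauss_lead_exists f : 0 < gauss f -> exists n a, gauss_lead f n a.
Proof.
move=> f0.
have [n0 /eqP en0] := gauss_attained f0.
have ub n : beta f`_n * r ^+ n == gauss f -> (n <= size f)%N.
  move=> /eqP E; rewrite leqNgt; apply/negP => /ltnW fn.
  by move: f0; rewrite -E nth_default // (seminorm0 zb) mul0r ltxx.
case: (ex_maxnP (ex_intro _ n0 en0) ub) => n /eqP En nmax.
exists n, f`_n, (take_poly n.+1 f); first by rewrite size_take_poly coef_take_poly ltnSn.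
split=> //; apply: gauss_lt => // i; rewrite coefB coef_take_poly ltnS.
case: leqP => [_|ni]; first by rewrite subrr (seminorm0 zb) mul0r.
rewrite subr0 lt_neqAle coef_gauss andbT; apply/negP => /nmax.
by rewrite leqNgt ni.
Qed.

Lemma coef_mul_top f g m n : (size f <= m.+1)%N -> (size g <= n.+1)%N ->
  (f * g)`_(m + n)%N = f`_m * g`_n.
Proof.
move=> fm gn; rewrite coefM.
have mlt : (m < (m + n).+1)%N by rewrite ltnS leq_addr.
rewrite (bigD1 (Ordinal mlt)) //= addKn big1 ?addr0 // => -[i ilt] /= /eqP im.
have [mi|mi] := ltnP m i; first by rewrite nth_default ?mul0r // (leq_trans fm).
have {}mi : (i < m)%N by rewrite ltn_neqAle mi andbT; apply/eqP => E; apply/im/val_inj.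
rewrite [g`_ _]nth_default ?mulr0 //; apply: leq_trans gn _.
by rewrite ltn_subRL ltn_add2r.
Qed.

(** By the isosceles property the coefficients of index n of f and g have the same seminorm; r ^+ n
    is nonzero because M is positive. *)
Lemma gauss_near_top f g M n : gauss (f - g) < M -> beta g`_n * r ^+ n = M -> M <= gauss f.
Proof.
move=> fg gM; apply: le_trans (coef_gauss f n).
have rn : 0 < r ^+ n.
  rewrite lt_def exprn_ge0 // andbT; apply/eqP => rn.
  by move: (le_lt_trans (gauss_ge0 _) fg); rewrite -gM rn mulr0 ltxx.
rewrite -gM ler_pM2r // (seminorm_eq zb (y := g`_n)) //.
by rewrite -(ltr_pM2r rn) gM -coefB; exact: le_lt_trans (coef_gauss _ _) fg.
Qed.

(** Gauss's lemma: the truncations f' and g' have a product close to f g, whose top coefficient a b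
    has weight exactly the product of the two norms. *)
Lemma gauss_multiplicative : multiplicative_seminorm beta -> multiplicative_seminorm gauss.
Proof.
move=> [_ b1 bM]; split=> [//||f g]; first by rewrite -[1]/(1%:P) gaussC.
apply/eqP; rewrite eq_le; case: (gauss_submul) => _ _ -> /=.
have [->|f0] := eqVneq (gauss f) 0; first by rewrite mul0r gauss_ge0.
have {}f0 : 0 < gauss f by rewrite lt_def f0 gauss_ge0.
have [->|g0] := eqVneq (gauss g) 0; first by rewrite mulr0 gauss_ge0.
have {}g0 : 0 < gauss g by rewrite lt_def g0 gauss_ge0.
have [m [a [f' [fm fa] [ff' fE]]]] := gauss_lead_exists f0.
have [n [b [g' [gn gb] [gg' gE]]]] := gauss_lead_exists g0.
apply: (@gauss_near_top _ (f' * g') _ (m + n)).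
  exact (submul_near gauss_submul f0 g0 ff' (lexx _) gg' (lexx _)).
by rewrite coef_mul_top // fa gb bM exprD mulrACA fE gE.
Qed.

(** The top coefficient of a power of the truncation is the same power of one coefficient, so
    power-multiplicativity of [beta] suffices. *)
Lemma gauss_power_multiplicative :
  power_multiplicative_seminorm beta -> power_multiplicative_seminorm gauss.
Proof.
move=> [_ bX]; split=> [|f n n0]; first exact: gauss_submul.
apply/eqP; rewrite eq_le (submulX_le gauss_submul) //=.
have [->|f0] := eqVneq (gauss f) 0; first by rewrite expr0n (gtn_eqF n0) gauss_ge0.
have {}f0 : 0 < gauss f by rewrite lt_def f0 gauss_ge0.
have [m [a [g [gm ga] [fg fE]]]] := gauss_lead_exists f0.
have [gnm gna] : (size (g ^+ n) <= (m * n).+1)%N /\ (g ^+ n)`_(m * n) = a ^+ n.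
  elim: (n) => [|k [IHs IHc]]; first by rewrite muln0 expr0 size_poly1 coef1.
  rewrite exprS mulnS coef_mul_top // ga IHc exprS; split=> //.
  apply: leq_trans (size_polyMleq _ _) _; rewrite -subn1 leq_subLR.
  by apply: leq_trans (leq_add gm IHs) _; rewrite addSn addnS add1n.
apply: (@gauss_near_top _ (g ^+ n) _ (m * n)).
  exact (submulX_near gauss_submul n f0 fg (lexx _)).
by rewrite gna bX // exprM -exprMn fE.
Qed.

End Gauss.

(** * The quotient seminorm on A[T]/(T - a) *)

Section QuotientGauss.
Variables (K : realType) (A : comNzRingType) (beta : A -> K) (r : K) (a : A).
Hypotheses (sb : submultiplicative_seminorm beta) (r0 : 0 <= r).
Implicit Types f g : {poly A}.
Local Notation gauss := (gauss beta r).
Local Notation H := (quotient_gauss beta r a).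

Let gb : submultiplicative_seminorm gauss. Proof. exact: gauss_submul. Qed.
Let zg : seminorm gauss. Proof. by case: gb. Qed.

(** Members of the coset of x modulo T - a take the value x at a; the factor theorem gives the
    converse in [quotient_gauss_le]. *)
Lemma quotient_gauss_ge x M : (forall f, f.[a] = x -> M <= gauss f) -> M <= H x.
Proof.
move=> h; apply: lb_le_inf.
  by exists (gauss x%:P), x%:P => //; exists 0; rewrite mul0r addr0.
move=> _ [_ [g ->] <-]; apply: h.
by rewrite hornerD hornerC hornerM hornerXsubC subrr mulr0 addr0.
Qed.

Lemma quotient_gauss_le f : H f.[a] <= gauss f.
Proof.
apply: ge_inf; first by exists 0 => _ [g _ <-]; exact: gauss_ge0.
exists f => //.
have /factor_theorem[g E] : root (f - f.[a]%:P) a by rewrite /root hornerD hornerN hornerC subrr.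
by exists g; rewrite -E addrC subrK.
Qed.

Lemma quotient_gauss_lt x M : H x < M -> exists2 f, f.[a] = x & gauss f < M.
Proof.
move=> xM; apply: contrapT => h.
suff : M <= H x by rewrite leNgt xM.
apply: quotient_gauss_ge => f fx; rewrite leNgt; apply/negP => fM.
by apply: h; exists f.
Qed.

Lemma quotient_gauss_ge0 x : 0 <= H x.
Proof. by apply: quotient_gauss_ge => f _; exact: gauss_ge0. Qed.

Lemma quotient_gauss_bounded : bounded_by H beta.
Proof. by move=> x; have := quotient_gauss_le x%:P; rewrite hornerC gaussC. Qed.

Lemma quotient_gauss_root : H a <= r.
Proof.
by have := quotient_gauss_le 'X; rewrite hornerX => /le_trans; apply; exact: gaussX.
Qed.

Lemma quotient_gauss_submul : submultiplicative_seminorm H.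
Proof.
split=> [||x y].
- split=> [x||x y]; first exact: quotient_gauss_ge0.
    apply/eqP; rewrite eq_le quotient_gauss_ge0 andbT.
    by apply: le_trans (quotient_gauss_bounded 0) _; case: sb => -[_ ->].
  rewrite leNgt; apply/negP; rewrite gt_max => /andP[].
  move=> /quotient_gauss_lt[f fx fM] /quotient_gauss_lt[g gy gM].
  have : H (x - y) < H (x - y); last by rewrite ltxx.
  apply: le_lt_trans (seminormB_lt zg fM gM).
  by have := quotient_gauss_le (f - g); rewrite hornerD hornerN fx gy.
- by apply: le_trans (quotient_gauss_bounded 1) _; case: sb.
rewrite leNgt; apply/negP => lt.
(* M lies strictly between H x and H (x y) / H y, so x and y have representatives of norms below M
   and H (x y) / M; if H y = 0, any M above H x will do. *)
have [M xM My] : exists2 M, H x < M & M * H y < H (x * y).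
  have [y0|y0] := eqVneq (H y) 0.
    by exists (H x + 1); rewrite ?ltrDl // y0 mulr0; rewrite y0 mulr0 in lt.
  have {}y0 : 0 < H y by rewrite lt_def y0 quotient_gauss_ge0.
  exists ((H x + H (x * y) / H y) / 2).
    by rewrite midf_lt // ltr_pdivlMr.
  by rewrite -ltr_pdivlMr // midf_lt // ltr_pdivlMr.
have M0 : 0 < M := le_lt_trans (quotient_gauss_ge0 x) xM.
have [f fx fM] := quotient_gauss_lt xM.
have : H y < H (x * y) / M by rewrite ltr_pdivlMr // mulrC.
move=> /quotient_gauss_lt[g gy gM].
have : H (x * y) <= gauss (f * g).
  by have := quotient_gauss_le (f * g); rewrite hornerM fx gy.
rewrite leNgt => /negP; apply.
have := submul_lt gb gM (ltW fM) M0.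
by rewrite divfK ?(gt_eqF M0) // mulrC.
Qed.

(** A representative of x, evaluated at a term by term, bounds H' x by its Gauss norm. *)
Lemma quotient_gauss_universal (H' : A -> K) : seminorm H' ->
  (forall x i, H' (x * a ^+ i) <= beta x * r ^+ i) -> bounded_by H' H.
Proof.
move=> zH' h x; apply: quotient_gauss_ge => f <-.
rewrite horner_coef; apply: (seminorm_sum zH') => [|i _]; first exact: gauss_ge0.
by apply: le_trans (h _ _) (coef_gauss _ sb _ _).
Qed.

End QuotientGauss.

(** p^n divides i C(p^n, i), so if p did not divide the binomial coefficient, p^n would divide i. *)
Lemma dvdn_bin_prime_exp (p n i : nat) : prime p -> (0 < i < p ^ n)%N ->
  (p %| 'C(p ^ n, i))%N.
Proof.
move=> hp /andP[i0 ilt]; apply: contraT => npC.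
have : (p ^ n %| i)%N.
  rewrite -(@Gauss_dvdr _ 'C(p ^ n, i)); last by rewrite coprimeXl ?prime_coprime.
  by case: i i0 {ilt npC} => // i _; rewrite mulnC -mul_bin_diag dvdn_mulr.
by move=> /(dvdn_leq i0); rewrite leqNgt ilt.
Qed.

(** * Multiplicativity of Teichmuller lifts *)

Section WittTeichmuller.
Variables (p : nat) (hp : prime p) (A : comNzRingType).
Local Notation W := (witt hp A).
Local Notation teich := (teich hp).

Lemma teich0 : teich 0 = 0 :> W. Proof. by []. Qed.

(** The ghost components a^(p^n) of [a] are multiplicative in a and determine a Witt vector over
    integer polynomials; the general case follows by evaluation. *)
Lemma teichM (a b : A) : teich (a * b) = teich a * teich b :> W.
Proof.
pose f := zev (fun i : wvar => if i.1 == 0%N then a else b).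
have -> : a = f (zvar (0, 0)%N) by rewrite zev_var.
have -> : b = f (zvar (1, 0)%N) by rewrite zev_var.
rewrite -rmorphM -!wmap_teich -[RHS]wmapM; congr wmap.
by apply: witt_ghost_inj => n; rewrite !wsimp exprMn.
Qed.

Lemma teichX (a : A) n : teich (a ^+ n) = teich a ^+ n :> W.
Proof. by elim: n => [//|n IH]; rewrite !exprS teichM IH. Qed.

End WittTeichmuller.

(** * Bounds on the Teichmuller coordinates of differences and products *)

Section TeichmullerCoordinates.
Variables (p : nat) (hp : prime p) (R : comNzRingType).
Hypotheses (charR : p \in [pchar R]) (perfR : bijective (fun a : R => a ^+ p)).
Local Notation W := (witt hp R).
Local Notation teich := (teich hp).
Implicit Types (x y z : W) (a : R).

Let pR : p%:R = 0 :> R. Proof. exact: pcharf0. Qed.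

Lemma wres_eq0_dvd x : wres x = 0 -> exists y, x = p%:R * y.
Proof.
by move=> x0; have [y ->] := witt_decomp_mulp pR perfR x; exists y; rewrite x0 teich0 add0r.
Qed.

(** Prepending a to the coordinates of y yields a Teichmuller series of the sum, and such series are
    unique. *)
Lemma tcoord_cons a y i :
  tcoord (teich a + p%:R * y) i = if i is j.+1 then tcoord y j else a.
Proof.
suff h : teich_series (teich a + p%:R * y) (fun i => if i is j.+1 then tcoord y j else a).
  by rewrite (teich_series_unique pR perfR (tcoordP _ pR perfR) h).
case=> [|n]; first by exists (teich a + p%:R * y); rewrite big_ord0 add0r mul1r.
have [z E] := tcoordP y pR perfR n; exists z.
rewrite big_ord_recl expr0 mul1r -addrA {1}E mulrDr mulr_sumr exprS mulrA.
by congr (_ + (_ + _)); apply: eq_bigr => j _; rewrite exprS mulrA.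
Qed.

Lemma wres_tcoord x : wres x = tcoord x 0.
Proof.
have [y ->] := witt_decomp_mulp pR perfR x.
by rewrite tcoord_cons rmorphD rmorphM /= rmorph_nat pR mul0r addr0.
Qed.

Lemma tcoord_mulp x i : tcoord (p%:R * x) i = if i is j.+1 then tcoord x j else 0.
Proof. by rewrite -(add0r (_ * _)) -[0]teich0 tcoord_cons. Qed.

Lemma tcoord_zero i : tcoord (0 : W) i = 0.
Proof. by elim: i => [|i IH]; rewrite -(mulr0 p%:R) tcoord_mulp. Qed.

Lemma tcoord_teich a i : tcoord (teich a) i = if i is 0 then a else 0.
Proof.
rewrite -(addr0 (teich a)) -(mulr0 p%:R) tcoord_cons.
by case: i => // i; exact: tcoord_zero.
Qed.

Lemma tcoord_teichM a x i : tcoord (teich a * x) i = a * tcoord x i.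
Proof.
elim: i x => [|i IH] x; have [y ->] := witt_decomp_mulp pR perfR x;
  by rewrite mulrDr -teichM mulrCA !tcoord_cons.
Qed.

Lemma tcoord_subres x i : tcoord (x - teich (wres x)) i = if i is 0 then 0 else tcoord x i.
Proof.
have [y ->] := witt_decomp_mulp pR perfR x.
rewrite rmorphD rmorphM /= rmorph_nat pR mul0r addr0 [teich _ + _]addrC addrK tcoord_mulp addrC.
by case: i => // i; rewrite tcoord_cons.
Qed.

Lemma perfect_root n a : exists b, b ^+ (p ^ n) = a.
Proof.
case: perfR => g _ gK; elim: n a => [|n IH] a; first by exists a; rewrite expn0 expr1.
by have [b E] := IH (g a); exists b; rewrite expnSr exprM E; exact: gK.
Qed.

Section Bounds.
Variables (K : realType) (alpha : R -> K).
Hypothesis alpha_pm : power_multiplicative_seminorm alpha.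

Let sa : submultiplicative_seminorm alpha. Proof. by case: alpha_pm. Qed.
Let za : seminorm alpha. Proof. by case: sa. Qed.

(** An algebraic stand-in for coordinate bounds, closed under subtraction by construction; for
    [tbnd] that closure has to be proved. *)
Inductive tspan (b : nat -> K) : W -> Prop :=
| tspan0 : tspan b 0
| tspan_gen i a : alpha a <= b i -> tspan b (p%:R ^+ i * teich a)
| tspanB x y : tspan b x -> tspan b y -> tspan b (x - y).

Lemma tspanD b x y : tspan b x -> tspan b y -> tspan b (x + y).
Proof.
by move=> bx by_; rewrite -(opprK y) -(sub0r y); do !apply: tspanB => //; exact: tspan0.
Qed.

Lemma tspan_sum b (I : Type) (r : seq I) (P : pred I) (F : I -> W) :
  (forall i, P i -> tspan b (F i)) -> tspan b (\sum_(i <- r | P i) F i).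
Proof.
move=> h; apply: (big_ind (tspan b)) => //; first exact: tspan0.
by move=> x y; exact: tspanD.
Qed.

Lemma tspan_le b c x : (forall i, b i <= c i) -> tspan b x -> tspan c x.
Proof.
move=> bc; elim=> [|i a h|y z _ hy _ hz]; [exact: tspan0| |exact: tspanB].
by apply: tspan_gen; apply: le_trans h _.
Qed.

Lemma tspanM b c d x y : (forall i, 0 <= b i) ->
  (forall i j, b i * c j <= d (i + j)%N) ->
  tspan b x -> tspan c y -> tspan d (x * y).
Proof.
move=> b0 bcd; elim=> [|i a ha|x1 x2 _ h1 _ h2] cy; first by rewrite mul0r; exact: tspan0.
  elim: cy => [|j a' ha'|y1 y2 _ h1 _ h2]; first by rewrite mulr0; exact: tspan0.
    rewrite mulrACA -exprD -teichM; apply: tspan_gen.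
    by apply: le_trans (bcd i j); exact: submul_le.
  by rewrite mulrBr; exact: tspanB.
by rewrite mulrBl; apply: tspanB; [exact: h1|exact: h2].
Qed.

(* [a + b] = lim ([a^(1/p^n)] + [b^(1/p^n)])^(p^n), and the inner binomial
   coefficients are divisible by p. *)
Lemma teichD_mod (m : K) a b n : alpha a <= m -> alpha b <= m ->
  exists y z, teich (a + b) = teich a + teich b + p%:R * y + p%:R ^+ n * z
    /\ tspan (fun=> m) y.
Proof.
have [a' <-] := perfect_root n a; have [b' <-] := perfect_root n b.
case: (alpha_pm) => _ aX; have p0 : (0 < p ^ n)%N by rewrite expn_gt0 prime_gt0.
rewrite !aX // => am bm.
have m0 : 0 <= m by apply: le_trans am; rewrite exprn_ge0 ?(seminorm_ge0 za).
have : eqi p%:R (teich (a' + b')) (teich a' + teich b').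
  have /wres_eq0_dvd[y E] : wres (teich (a' + b') - (teich a' + teich b')) = 0.
    by rewrite rmorphB rmorphD /= subrr.
  by exists y.
move=> /(eqi_exppn n)[z /eqP]; rewrite subr_eq -teichX => /eqP.
rewrite exprDn_pchar; last by rewrite pnatX (pnatE _ hp) charR.
move=> ->; rewrite exprDn !teichX.
move: am bm p0 (@dvdn_bin_prime_exp p n ^~ hp).
case: (p ^ n)%N => [_ _|q am bm _ dvd]; first by rewrite ltnn.
rewrite big_ord_recl big_ord_recr /= bin0 binn subn0 subnn !expr0 !mulr1n mulr1 mul1r.
pose y := \sum_(i < q)
  teich (a' ^+ (q.+1 - bump 0 i) * b' ^+ bump 0 i) *+ ('C(q.+1, bump 0 i) %/ p).
exists y, (p%:R * z); split.
  rewrite [p%:R ^+ n * _]mulrA -exprSr [RHS]addrC; congr (_ + _).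
  rewrite addrCA addrC -[RHS]addrA -[LHS]addrA; congr (_ + (_ + _)).
  rewrite mulr_sumr; apply: eq_bigr => i _.
  rewrite teichM !teichX mulr_natl -mulrnA divnK // dvd // /bump /= add1n.
  by rewrite !ltnS ltn_ord.
apply: tspan_sum => i _; set t := teich _.
suff ht : tspan (fun=> m) t.
  elim: (_ %/ _)%N => [|k IH]; first by rewrite mulr0n; exact: tspan0.
  by rewrite mulrS; exact: tspanD.
rewrite -[t]mul1r -(expr0 p%:R); apply: (@tspan_gen (fun=> m)).
have le : (bump 0 i <= q.+1)%N by rewrite /bump /= add1n ltnS ltnW.
(* Here [q.+1] is p^n, so M ^+ q.+1 is one of the two powers assumed to be at most m; it bounds
   every mixed monomial. *)
pose M := Num.max (alpha a') (alpha b').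
apply: le_trans (_ : M ^+ q.+1 <= m); last first.
  by rewrite /M maxEle; case: ifP.
rewrite -(subnK le) exprD subnK //.
by apply: (submul_le sa); apply: (submulX_le sa); rewrite le_max lexx ?orbT.
Qed.

(** Splits off coordinate 0. The carry from subtracting two lifts is bounded by b 0, hence by every
    later b i, which is where monotonicity enters. *)
Lemma tspan_split b x n : (forall i, 0 <= b i) -> (forall i, b i <= b i.+1) -> tspan b x ->
  exists y z, [/\ x = teich (wres x) + p%:R * y + p%:R ^+ n * z,
    tspan (fun i => b i.+1) y & alpha (wres x) <= b 0%N].
Proof.
move=> b0 bS; elim=> [|i a h|{}x y _ [x' [x'' [ex hx rx]]] _ [y' [y'' [ey hy ry]]]].
- exists 0, 0; rewrite rmorph0 teich0 !mulr0 !addr0 (seminorm0 za); split=> //; exact: tspan0.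
- case: i h => [|i] h.
    exists 0, 0; rewrite mul1r wres_teich !mulr0 !addr0; split=> //; exact: tspan0.
  exists (p%:R ^+ i * teich a), 0.
  rewrite !exprS -!mulrA rmorphM /= rmorph_nat pR mul0r teich0 add0r mulr0 addr0.
  by rewrite (seminorm0 za); split=> //; exact: tspan_gen.
have rxy : alpha (wres (x - y)) <= b 0%N by rewrite rmorphB; exact: (seminormB za).
(* The addition formula is applied to the residues of x - y and y, whose sum is the residue of x. *)
have [u [v [euv hu]]] := teichD_mod n rxy ry.
exists (x' - y' + u), (x'' - y'' + v); split=> //; last first.
  apply: tspanD; first exact: tspanB.
  apply: (tspan_le _ hu) => i; elim: i => [|i IH]; first exact: bS.
  exact: le_trans IH (bS _).
have -> : teich (wres (x - y)) =
    teich (wres x) - teich (wres y) - p%:R * u - p%:R ^+ n * v.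
  by rewrite -[in wres x](subrK y x) [wres (_ + y)]rmorphD euv; ring.
rewrite {1}ex {1}ey; ring.
Qed.

(** Induction on n, splitting off coordinate 0 and shifting b. The error p^(n+1) z cannot reach
    coordinate n. *)
Lemma tspan_coord b n y z : (forall i, 0 <= b i) -> (forall i, b i <= b i.+1) -> tspan b y ->
  alpha (tcoord (y + p%:R ^+ n.+1 * z) n) <= b n.
Proof.
move=> b0 bS; elim: n b b0 bS y z => [|n IH] b b0 bS y z hy.
  have [u [v [ey hu ry]]] := tspan_split 1 b0 bS hy.
  rewrite ey -wres_tcoord !rmorphD !rmorphM !rmorphXn !rmorph_nat pR.
  by rewrite !expr0n /= !mul0r !addr0.
(* Precision n + 2 leaves p^(n+1) once a factor p is taken out, as the induction hypothesis
   requires. *)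
have [u [v [ey hu ry]]] := tspan_split n.+2 b0 bS hy.
rewrite ey -!addrA -mulrDr exprS -mulrA -mulrDr tcoord_cons.
exact: (IH (fun i => b i.+1)).
Qed.

Definition tbnd (b : nat -> K) x := forall i, alpha (tcoord x i) <= b i.

(** Coordinate i depends only on x modulo p^(i+1). With [tbnd_tspan] this makes [tbnd b] the p-adic
    closure of [tspan b], so differences and products can be bounded on generators. *)
Lemma tspan_tbnd b x : (forall i, 0 <= b i) -> (forall i, b i <= b i.+1) ->
  (forall n, exists y z, tspan b y /\ x = y + p%:R ^+ n * z) -> tbnd b x.
Proof. by move=> b0 bS h i; have [y [z [hy ->]]] := h i.+1; exact: tspan_coord. Qed.

Lemma tbnd_tspan b x n : tbnd b x -> exists y z, tspan b y /\ x = y + p%:R ^+ n * z.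
Proof.
move=> bx; have [z xz] := tcoordP x pR perfR n; do 2 eexists; split; last exact: xz.
by apply: tspan_sum => i _; apply: tspan_gen.
Qed.

Lemma tbndB b x y : (forall i, 0 <= b i) -> (forall i, b i <= b i.+1) ->
  tbnd b x -> tbnd b y -> tbnd b (x - y).
Proof.
move=> b0 bS bx by_; apply: tspan_tbnd => // n.
have [x' [u [hx ->]]] := tbnd_tspan n bx; have [y' [v [hy ->]]] := tbnd_tspan n by_.
exists (x' - y'), (u - v); split; first exact: tspanB.
by rewrite mulrBr opprD addrACA.
Qed.

Lemma tbndM b c d x y : (forall i, 0 <= b i) ->
  (forall i, 0 <= d i) -> (forall i, d i <= d i.+1) ->
  (forall i j, b i * c j <= d (i + j)%N) -> tbnd b x -> tbnd c y -> tbnd d (x * y).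
Proof.
move=> b0 d0 dS bcd bx cy; apply: tspan_tbnd => // n.
have [x' [u [hx ->]]] := tbnd_tspan n bx; have [y' [v [hy ->]]] := tbnd_tspan n cy.
exists (x' * y'), (u * y' + x' * v + u * (p%:R ^+ n * v)).
split; [exact: tspanM hx hy | ring].
Qed.

End Bounds.
End TeichmullerCoordinates.

(* [lambda] with the weights p^-i replaced by q^-i; the supremum norm q = 1 is
   needed next to q = p. *)
Definition lam (K : realType) (p : nat) (hp : prime p) (R : comNzRingType)
    (alpha : R -> K) (q : K) (x : witt hp R) : K :=
  sup (range (fun i => q ^- i * alpha (tcoord x i))).

(** * Weighted norms on Witt vectors *)

Section WittSeminorms.
Variables (p : nat) (hp : prime p) (R : comNzRingType).
Hypotheses (charR : p \in [pchar R]) (perfR : bijective (fun a : R => a ^+ p)).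
Variables (K : realType) (alpha : R -> K).
Hypothesis alpha_pm : power_multiplicative_seminorm alpha.
Hypothesis alpha_le1 : forall a, alpha a <= 1.
Local Notation W := (witt hp R).
Local Notation teich := (teich hp).
Implicit Types (x y : W).

Let sa : submultiplicative_seminorm alpha. Proof. by case: alpha_pm. Qed.
Let za : seminorm alpha. Proof. by case: sa. Qed.
Let pR : p%:R = 0 :> R. Proof. exact: pcharf0. Qed.

Lemma natp_ge1 : 1 <= p%:R :> K. Proof. by rewrite ler1n prime_gt0. Qed.

Lemma natp_gt1 : 1 < p%:R :> K. Proof. by rewrite ltr1n prime_gt1. Qed.

Lemma natp_gt0 : 0 < p%:R :> K. Proof. by rewrite ltr0n prime_gt0. Qed.

Section Weight.
Variable q : K.
Hypothesis q1 : 1 <= q.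

Let q0 : 0 < q. Proof. exact: lt_le_trans q1. Qed.
Let qi0 i : 0 < q ^+ i. Proof. exact: exprn_gt0. Qed.

Lemma coord_lam x i : alpha (tcoord x i) <= lam alpha q x * q ^+ i.
Proof.
rewrite -ler_pdivrMr // mulrC; apply: ub_le_sup; last by exists i.
exists 1 => _ [j _ <-]; rewrite mulrC ler_pdivrMr // mul1r.
by apply: le_trans (alpha_le1 _) _; exact: exprn_ege1.
Qed.

Lemma lam_le x M : (forall i, alpha (tcoord x i) <= M * q ^+ i) -> lam alpha q x <= M.
Proof.
move=> h; apply: ge_sup; first by exists (q ^- 0 * alpha (tcoord x 0)), 0%N.
by move=> _ [j _ <-]; rewrite mulrC ler_pdivrMr.
Qed.

Lemma lam_ge0 x : 0 <= lam alpha q x.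
Proof.
have := coord_lam x 0; rewrite expr0 mulr1; apply: le_trans.
exact: (seminorm_ge0 za).
Qed.

Lemma lam_le1 x : lam alpha q x <= 1.
Proof.
apply: lam_le => i; rewrite mul1r; apply: le_trans (alpha_le1 _) _.
exact: exprn_ege1.
Qed.

Lemma lam_mulp_le x N : (forall i, alpha (tcoord x i) <= N * q ^+ i.+1) ->
  0 <= N -> lam alpha q (p%:R * x) <= N.
Proof.
move=> h N0; apply: lam_le => -[|i]; rewrite tcoord_mulp ?h //.
by rewrite (seminorm0 za) mulr_ge0 ?exprn_ge0 // ltW.
Qed.

Lemma lam_teich a : lam alpha q (teich a) = alpha a.
Proof.
apply/eqP; rewrite eq_le; apply/andP; split.
  apply: lam_le => -[|i]; rewrite tcoord_teich // ?mulr1 //.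
  by rewrite (seminorm0 za) mulr_ge0 ?(seminorm_ge0 za) // ltW.
by have := coord_lam (teich a) 0; rewrite tcoord_teich // mulr1.
Qed.

Let weight_ge0 M i : 0 <= M -> 0 <= M * q ^+ i.
Proof. by move=> M0; rewrite mulr_ge0 // ltW. Qed.

Let weightS M i : 0 <= M -> M * q ^+ i <= M * q ^+ i.+1.
Proof. by move=> M0; rewrite ler_wpM2l // exprS ler_peMl // ltW. Qed.

(** For q >= 1 the bounds M q^i are nondecreasing in i, and they multiply as [tbndM] requires. *)
Lemma lam_submul : submultiplicative_seminorm (@lam K p hp R alpha q).
Proof.
split=> [||x y].
- split=> [x||x y]; first exact: lam_ge0.
    by rewrite -[0]/(teich 0) lam_teich (seminorm0 za).
  have m0 : 0 <= Num.max (lam alpha q x) (lam alpha q y) by rewrite le_max lam_ge0.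
  apply: lam_le.
  pose m := Num.max (lam alpha q x) (lam alpha q y).
  apply: (tbndB charR perfR alpha_pm (b := fun i => m * q ^+ i)) => i.
  - exact: weight_ge0.
  - exact: weightS.
  - by apply: le_trans (coord_lam x i) _; rewrite ler_pM2r // le_max lexx.
  - by apply: le_trans (coord_lam y i) _; rewrite ler_pM2r // le_max lexx orbT.
- by rewrite -[1]/(teich 1) lam_teich; case: sa.
apply: lam_le.
apply: (tbndM charR perfR alpha_pm (b := fun i => lam alpha q x * q ^+ i)
  (c := fun i => lam alpha q y * q ^+ i)
  (d := fun i => lam alpha q x * lam alpha q y * q ^+ i)) => i.
- by apply: weight_ge0; exact: lam_ge0.
- by apply: weight_ge0; rewrite mulr_ge0 ?lam_ge0.
- by apply: weightS; rewrite mulr_ge0 ?lam_ge0.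
- by move=> j; rewrite mulrACA -exprD.
- exact: coord_lam.
- exact: coord_lam.
Qed.

End Weight.

Let pk0 i : 0 < p%:R ^+ i :> K. Proof. by rewrite exprn_gt0 // natp_gt0. Qed.

Lemma lambda_submul : submultiplicative_seminorm (@lambda K p hp R alpha).
Proof. exact: lam_submul natp_ge1. Qed.

Let sl := lambda_submul.
Let zl : seminorm (@lambda K p hp R alpha). Proof. by case: sl. Qed.

Lemma lambda_teich a : lambda alpha (teich a) = alpha a.
Proof. exact: lam_teich natp_ge1 _. Qed.

Lemma lambda_le1 x : lambda alpha x <= 1.
Proof. exact: lam_le1 natp_ge1 _. Qed.

Lemma coord_lambda x i : p%:R ^- i * alpha (tcoord x i) <= lambda alpha x.
Proof. by rewrite mulrC ler_pdivrMr //; exact: coord_lam natp_ge1 _ _. Qed.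

Lemma lambda_le x M : (forall i, p%:R ^- i * alpha (tcoord x i) <= M) -> lambda alpha x <= M.
Proof. by move=> h; apply: (lam_le natp_ge1) => i; have := h i; rewrite mulrC ler_pdivrMr. Qed.

Lemma lambda_p : lambda alpha (p%:R : W) <= p%:R^-1.
Proof.
rewrite -(mulr1 p%:R); apply: (lam_mulp_le natp_ge1) => [i|]; last first.
  by rewrite invr_ge0 ltW ?natp_gt0.
rewrite exprS mulKf ?gt_eqF ?natp_gt0 //; apply: le_trans (alpha_le1 _) _.
exact: exprn_ege1 natp_ge1.
Qed.

(** Without coordinate 0 all remaining weights p^-i are at most p^-1; this is the source of the
    factor gained in each approximation. *)
Lemma lambda_subres x : lambda alpha (x - teich (wres x)) <= p%:R^-1 * lam alpha 1 x.
Proof.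
have l0 : 0 <= p%:R^-1 * lam alpha 1 x.
  by rewrite mulr_ge0 ?invr_ge0 ?ler0n // lam_ge0.
apply: lambda_le => -[|i]; rewrite tcoord_subres //; first by rewrite (seminorm0 za) mulr0.
have := coord_lam (lexx 1) x i.+1; rewrite expr1n mulr1 => h.
apply: ler_pM => //; rewrite ?(seminorm_ge0 za) ?invr_ge0 ?(ltW (pk0 _)) //.
rewrite lef_pV2 ?posrE ?natp_gt0 // exprS ler_peMr ?exprn_ege1 ?natp_ge1 //.
Qed.

Lemma lambda_mulpX x n : lambda alpha (p%:R ^+ n * x) <= p%:R ^- n.
Proof.
rewrite -(mulr1 (_ ^- n)) -exprVn.
by apply: (submul_le sl (submulX_le sl n lambda_p)); exact: lambda_le1.
Qed.

(* Addition of Witt vectors changes a Teichmuller coordinate only by terms coming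
   from the coordinates of lower index, which get an extra factor p^-1. *)
Definition lower (A : K) n x := lambda alpha x <= A /\ p%:R ^- n * alpha (tcoord x n) < A.

Lemma lower_lt A n x : lambda alpha x < A -> lower A n x.
Proof. by move=> xA; split; [exact: ltW|exact: le_lt_trans (coord_lambda _ _) xA]. Qed.

Lemma lowerB A n x y : 0 < A -> lower A n x -> lower A n y -> lower A n (x - y).
Proof.
move=> A0 [xA xn] [yA yn]; split; first exact: (seminormB zl).
(* The bound b below is A p^k except for B p^n at k = n. Including p^-1 A in B gives A <= B p, which
   keeps b nondecreasing. *)
pose B := Num.max (p%:R^-1 * A) (Num.max (p%:R ^- n * alpha (tcoord x n))
  (p%:R ^- n * alpha (tcoord y n))).
have BA : B < A by rewrite !gt_max xn yn gtr_pMl // invf_lt1 ?natp_gt1 ?natp_gt0.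
have pB : A <= B * p%:R by rewrite -ler_pdivrMr ?natp_gt0 // mulrC !le_max lexx.
have B0 : 0 <= B by rewrite le_max mulr_ge0 ?invr_ge0 ?ler0n // ltW.
pose b k := (if k == n then B else A) * p%:R ^+ k.
have bz (z : W) : lambda alpha z <= A -> p%:R ^- n * alpha (tcoord z n) <= B -> tbnd alpha b z.
  move=> zA zB i; rewrite /b -ler_pdivrMr // mulrC.
  by case: eqP => [->//|_]; exact: le_trans (coord_lambda _ _) zA.
apply: (le_lt_trans _ BA); rewrite mulrC ler_pdivrMr //.
have -> : B * p%:R ^+ n = b n by rewrite /b eqxx.
apply: (tbndB charR perfR alpha_pm) => [i|i||].
- by rewrite /b; case: eqP => _; rewrite mulr_ge0 ?exprn_ge0 ?ler0n // ltW.
- rewrite /b exprS mulrA ler_pM2r //; case: eqP => [<-|_].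
    by rewrite gtn_eqF // (le_trans (ltW BA)) // ler_peMr ?natp_ge1 // ltW.
  by case: eqP => [//|_]; rewrite ler_peMr ?natp_ge1 // ltW.
- by apply: bz => //; rewrite !le_max lexx !orbT.
- by apply: bz => //; rewrite !le_max lexx !orbT.
Qed.

Lemma lowerD A n x y : 0 < A -> lower A n x -> lower A n y -> lower A n (x + y).
Proof.
move=> A0 xA yA; rewrite -(opprK y) -(sub0r y); do !apply: lowerB => //.
by apply: lower_lt; rewrite (seminorm0 zl).
Qed.

(** * Polynomials with Teichmuller coefficients *)

Section Polynomials.
Variable r : K.
Hypothesis r0 : 0 <= r.
Local Notation gaussR := (gauss alpha r).
Local Notation gaussW := (gauss (@lambda K p hp R alpha) r).
Local Notation gauss1 := (gauss (@lam K p hp R alpha 1) r).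
Implicit Types (c : {poly R}) (f g : {poly W}).

(** Not a ring morphism, since [.] is not additive; products of such lifts are handled through their
    residues. *)
Definition teich_poly c : {poly W} := map_poly (@Defs.teich p hp R) c.

Lemma coef_teich_poly c i : (teich_poly c)`_i = teich c`_i.
Proof. by rewrite coef_map_id0. Qed.

Let s1 : submultiplicative_seminorm (@lam K p hp R alpha 1). Proof. exact: lam_submul. Qed.
Let sg1 : submultiplicative_seminorm gauss1. Proof. exact: gauss_submul. Qed.

Lemma gauss_subres f :
  gaussW (f - teich_poly (map_poly (@wres p hp R) f)) <= p%:R^-1 * gauss1 f.
Proof.
apply: gauss_le => [|i]; first by rewrite mulr_ge0 ?invr_ge0 ?ler0n ?gauss_ge0.
rewrite coefB coef_teich_poly coef_map.
apply: le_trans (ler_wpM2r (exprn_ge0 i r0) (lambda_subres _)) _.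
by rewrite -mulrA ler_wpM2l ?invr_ge0 ?ler0n // coef_gauss.
Qed.

Lemma gauss1_teich c : gauss1 (teich_poly c) <= gaussR c.
Proof.
apply: gauss_le => [|i]; first exact: gauss_ge0.
by rewrite coef_teich_poly lam_teich // coef_gauss.
Qed.

Lemma gauss_teich c : gaussW (teich_poly c) <= gaussR c.
Proof.
apply: gauss_le => [|i]; first exact: gauss_ge0.
by rewrite coef_teich_poly lambda_teich coef_gauss.
Qed.

Lemma wres_teich_poly c : map_poly (@wres p hp R) (teich_poly c) = c.
Proof. by apply/polyP => i; rewrite coef_map coef_teich_poly. Qed.

(** * The quotient seminorm defined by pi *)

Section Quotient.
Variable pi : W.
Hypothesis pi0_le : alpha (tcoord pi 0) <= p%:R^-1.
Hypothesis pi1_unit : exists u : R, tcoord pi 1 * u = 1.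
Hypothesis r_le : r <= p%:R^-1.
Local Notation H := (quotient_gauss (@lambda K p hp R alpha) r pi).

Let sgW : submultiplicative_seminorm gaussW. Proof. exact: gauss_submul. Qed.
Let zgW : seminorm gaussW. Proof. by case: sgW. Qed.
Let sH : submultiplicative_seminorm H. Proof. exact: quotient_gauss_submul. Qed.
Let zH : seminorm H. Proof. by case: sH. Qed.
Let H_lambda : bounded_by H (@lambda K p hp R alpha).
Proof. exact: quotient_gauss_bounded. Qed.
Let H_pi : H pi <= r. Proof. exact: quotient_gauss_root. Qed.
Let ip0 : 0 < p%:R^-1 :> K. Proof. by rewrite invr_gt0 natp_gt0. Qed.

Lemma pi_decomp : exists w, pi = teich (tcoord pi 0) + p%:R * w /\ wres w = tcoord pi 1.
Proof.
have [w E] := witt_decomp_mulp pR perfR pi; exists w.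
rewrite -(wres_tcoord charR perfR) -E; split=> //.
by rewrite E tcoord_cons -?wres_tcoord.
Qed.

Lemma lambda_pi : lambda alpha pi <= p%:R^-1.
Proof.
have [w [-> _]] := pi_decomp; apply: (seminormD zl); first by rewrite lambda_teich.
by have := lambda_mulpX w 1; rewrite expr1.
Qed.

(** Both the unit and its inverse have seminorm at most 1, so multiplication by either does not
    increase [alpha]. *)
Lemma alpha_pi1M a : alpha (tcoord pi 1 * a) = alpha a.
Proof.
have le (b d : R) : alpha (b * d) <= alpha d.
  by rewrite -(mul1r (alpha d)); exact: (submul_le sa).
case: pi1_unit => u pu; apply/eqP; rewrite eq_le le /=.
by rewrite -{1}(mul1r a) -pu mulrAC mulrC; exact: le.
Qed.

(* A geometric series inverts (pi - [pi_0]) / p up to p^n. *)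
Lemma p_approx n : exists v, eqi (p%:R ^+ n) p%:R ((pi - teich (tcoord pi 0)) * v).
Proof.
have [w [E pw]] := pi_decomp; case: pi1_unit => u pu.
have /(wres_eq0_dvd charR perfR)[z Ez] : wres (1 - w * teich u) = 0.
  by rewrite rmorphB rmorphM rmorph1 /= pw pu subrr.
exists (teich u * \sum_(i < n) (p%:R * z) ^+ i), (p%:R * z ^+ n).
have -> : pi - teich (tcoord pi 0) = p%:R * w by rewrite {1}E addrC addKr.
have := subrX1 (p%:R * z) n; rewrite exprMn => h.
have {}Ez : w * teich u = 1 - p%:R * z by rewrite -Ez subKr.
rewrite mulrA -(mulrA p%:R w) Ez -mulrA.
have -> : (1 - p%:R * z) * (\sum_(i < n) (p%:R * z) ^+ i) = 1 - p%:R ^+ n * z ^+ n.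
  by rewrite -[LHS]opprK -mulNr opprB -h opprB.
by ring.
Qed.

Lemma natp_small (e : K) : 0 < e -> exists n, p%:R ^- n < e.
Proof.
move=> e0; exists (Num.bound e^-1); rewrite -[ltRHS]invrK ltf_pV2 ?posrE ?invr_gt0 //.
apply: lt_le_trans (archi_boundP _) _; first by rewrite invr_ge0 ltW.
by rewrite -natrX ler_nat ltnW // ltn_expl // prime_gt1.
Qed.

(** The head of the Teichmuller expansion is bounded term by term, and its tail p^n z has seminorm
    at most p^-n. An upper bound for N thus only needs its value at p. *)
Lemma expansion_le (N : W -> K) (m M : K) x : submultiplicative_seminorm N ->
  bounded_by N (@lambda K p hp R alpha) -> N p%:R <= m -> 0 <= M ->
  (forall i, m ^+ i * alpha (tcoord x i) <= M) -> N x <= M.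
Proof.
move=> sN Nl Np M0 xM; have [zN _ _] := sN.
rewrite leNgt; apply/negP => MN.
have [n nN] := natp_small (le_lt_trans M0 MN).
have [z E] := tcoordP x pR perfR n.
suff : N x < N x by rewrite ltxx.
rewrite {1}E; apply: (seminormD_lt zN); last first.
  by apply: le_lt_trans nN; apply: le_trans (Nl _) _; exact: lambda_mulpX.
apply: le_lt_trans MN; apply: (seminorm_sum zN) => // i _.
apply: le_trans (xM i); apply: (submul_le sN); first exact: (submulX_le sN).
by apply: le_trans (Nl _) _; rewrite lambda_teich.
Qed.

(** Modulo p^n, p is (pi - [pi_0]) v with H v <= 1; for n large the error lies below H p if H p
    exceeds the bound. *)
Lemma quotient_gauss_p : H p%:R <= Num.max r (alpha (tcoord pi 0)).
Proof.
set m := Num.max _ _; have m0 : 0 <= m by rewrite le_max r0.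
rewrite leNgt; apply/negP => mp.
have [n nN] := natp_small (le_lt_trans m0 mp).
have [v [z /eqP]] := p_approx n; rewrite subr_eq addrC => /eqP E.
suff : H p%:R < H p%:R by rewrite ltxx.
rewrite {1}E; apply: (seminormD_lt zH); last first.
  by apply: le_lt_trans nN; apply: le_trans (H_lambda _) _; exact: lambda_mulpX.
apply: le_lt_trans mp; rewrite -(mulr1 m); apply: (submul_le sH).
  apply: (seminormB zH); first by rewrite le_max H_pi.
  by apply: le_trans (H_lambda _) _; rewrite lambda_teich le_max lexx orbT.
by apply: le_trans (H_lambda _) _; exact: lambda_le1.
Qed.

(* Substituting (X - [pi_0]) v for p in the Teichmuller expansion gives
   coefficients that are small in the supremum norm [lam alpha 1]. *)
Lemma expansion_poly x n : exists f e,
  x = f.[pi] + p%:R ^+ n * e /\ gauss1 f <= lambda alpha x.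
Proof.
have [v pv] := p_approx n; have [z E] := tcoordP x pR perfR n.
pose g := ('X - (teich (tcoord pi 0))%:P) * v%:P.
pose f := \sum_(i < n) (teich (tcoord x i))%:P * g ^+ i.
have g_le : gauss1 g <= p%:R^-1.
  rewrite -(mulr1 p%:R^-1); apply: (submul_le sg1).
    apply: seminormB; first by case: sg1.
      exact: le_trans (gaussX s1 r0) r_le.
    by rewrite gaussC // lam_teich.
  by rewrite gaussC // lam_le1.
have f_le : gauss1 f <= lambda alpha x.
  apply: seminorm_sum => [||i _]; first by case: sg1.
    exact: (seminorm_ge0 zl).
  apply: le_trans (coord_lambda x i); rewrite [leRHS]mulrC -exprVn; apply: (submul_le sg1).
    by rewrite gaussC // lam_teich.
  exact: (submulX_le sg1).
have [e Ee] : eqi (p%:R ^+ n) x f.[pi].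
  rewrite horner_sum {1}E -[X in eqi _ _ X]addr0; apply: eqiD; last first.
    by exists z; rewrite subr0.
  apply: (@eqi_sum _ _ _ (fun i => p%:R ^+ i * teich (tcoord x i))
    (fun i => ((teich (tcoord x i))%:P * g ^+ i).[pi])) => i _.
  rewrite mulrC hornerM hornerC horner_exp hornerM hornerXsubC hornerC.
  by apply: eqiM; [exact: eqi_refl|exact: eqiX].
by exists f, e; split=> //; rewrite -Ee addrC subrK.
Qed.

(** Each coefficient is rewritten by [expansion_poly]. The value at pi is kept modulo p^n, while
    [lambda] gives way to the larger supremum norm at no cost. *)
Lemma expansion_horner f n : exists g e,
  f.[pi] = g.[pi] + p%:R ^+ n * e /\ gauss1 g <= gaussW f.
Proof.
have [F hF] := choice (fun i => expansion_poly f`_i n).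
have [e he] := choice hF.
exists (\sum_(i < size f) F i * 'X^i), (\sum_(i < size f) e i * pi ^+ i); split.
  rewrite horner_sum mulr_sumr -big_split horner_coef; apply: eq_bigr => i _ /=.
  rewrite hornerM hornerXn mulrA -mulrDl; congr (_ * _).
  by case: (he i).
apply: seminorm_sum => [||i _]; first by case: sg1.
  exact: (seminorm_ge0 zgW).
apply: le_trans (coef_gauss r sl f i); apply: (submul_le sg1).
  by case: (he i).
exact: (submulX_le sg1) (gaussX s1 r0).
Qed.

(** A representative of norm below p H x suffices: replacing its rewritten coefficients by lifts of
    their residues gains p^-1. *)
Lemma quotient_gauss_approx x : 0 < H x ->
  exists c, H (x - (teich_poly c).[pi]) < H x.
Proof.
move=> x0; have : H x < p%:R * H x by rewrite ltr_pMl // natp_gt1.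
move=> /quotient_gauss_lt[f fx fH].
have [n nx] := natp_small x0.
have [g [e [E gf]]] := expansion_horner f n.
pose c := map_poly (@wres p hp R) g; exists c.
have -> : x - (teich_poly c).[pi] = (g - teich_poly c).[pi] + p%:R ^+ n * e.
  by rewrite -fx E hornerD hornerN addrAC.
apply: (seminormD_lt zH); last first.
  by apply: le_lt_trans nx; apply: le_trans (H_lambda _) _; exact: lambda_mulpX.
apply: le_lt_trans (quotient_gauss_le _ _ _ _) _.
apply: le_lt_trans (gauss_subres _) _.
rewrite mulrC ltr_pdivrMr ?natp_gt0 // mulrC.
exact: le_lt_trans gf fH.
Qed.

Lemma lambda_attained x : exists i, p%:R ^- i * alpha (tcoord x i) = lambda alpha x.
Proof.
have [] // := lambda_is_max (alpha := alpha) x; first exact: (seminorm_ge0 za).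
move=> a; rewrite /trivial_norm; case: eqP => [->|_]; last exact: alpha_le1.
by rewrite (seminorm0 za).
Qed.

(* Let j be maximal such that a coefficient g_i has its weight lambda(g_i) r^i
   equal to G = gauss g and reached at the coordinate j.  In the coefficient of
   X^i of f, the coordinate j + 1 of the term p [pi_1] g_i has weight G / p and
   cannot be cancelled, as [c_i] contributes to the coordinate 0 only. *)
Lemma gauss_teich_le c f : f.[pi] = (teich_poly c).[pi] -> gaussR c <= gaussW f.
Proof.
move=> fc.
have /factor_theorem[g fE] : root (f - teich_poly c) pi.
  by rewrite /root hornerD hornerN fc subrr.
have {}fE : f = teich_poly c + g * ('X - pi%:P) by rewrite -fE addrC subrK.
rewrite leNgt; apply/negP => fM; set M := gaussR c in fM; set G := gaussW g.
have M0 : 0 < M := le_lt_trans (gauss_ge0 _ _ _) fM.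
(* Otherwise f and g (X - pi) both have norm below M, hence so does T c, though its coefficients
   have the same seminorms as those of c. *)
have MG : M <= p%:R^-1 * G.
  rewrite leNgt; apply/negP => GM.
  suff : M < M by rewrite ltxx.
  apply: gauss_lt => // i; rewrite -lambda_teich -coef_teich_poly.
  apply: le_lt_trans (coef_gauss r sl _ i) _.
  have -> : teich_poly c = f - g * ('X - pi%:P) by rewrite fE addrK.
  apply: (seminormB_lt zgW) => //; apply: le_lt_trans GM; rewrite mulrC.
  apply: (submul_le sgW) => //; apply: (seminormB zgW).
    exact: le_trans (gaussX sl r0) r_le.
  by rewrite gaussC //; exact: lambda_pi.
have G0 : 0 < G by rewrite -(pmulr_rgt0 _ ip0); exact: lt_le_trans MG.
pose om i k := p%:R ^- k * alpha (tcoord g`_i k) * r ^+ i.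
have om_le i k : om i k <= G.
  by apply: le_trans (coef_gauss r sl g i); rewrite ler_wpM2r ?exprn_ge0 // coord_lambda.
have ex_j : exists j, `[< exists i, om i j = G >].
  have [i iG] := gauss_attained sl G0; have [j jg] := lambda_attained g`_i.
  by exists j; apply/asboolP; exists i; rewrite /om jg.
have [n nG] := natp_small G0.
(* Weights at coordinates beyond n are at most p^-n < G, as alpha and r are at most 1; so a maximal
   j exists. *)
have ub_j j : `[< exists i, om i j = G >] -> (j <= n)%N.
  move=> /asboolP[i ij]; rewrite leqNgt; apply/negP => nj.
  suff : G < G by rewrite ltxx.
  rewrite -{1}ij; apply: le_lt_trans nG.
  have r1 : r <= 1 by apply: le_trans r_le _; rewrite invf_le1 ?natp_gt0 ?natp_ge1.
  rewrite /om -[leRHS]mulr1; apply: ler_pM; rewrite ?exprn_ile1 ?exprn_ge0 //.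
    by rewrite mulr_ge0 ?invr_ge0 ?(ltW (pk0 _)) ?(seminorm_ge0 za).
  rewrite -[leRHS]mulr1; apply: ler_pM; rewrite ?invr_ge0 ?(ltW (pk0 _)) ?(seminorm_ge0 za) //.
  by rewrite lef_pV2 ?posrE // ler_eXn2l ?natp_gt1 // ltnW.
case: (ex_maxnP ex_j ub_j) => j /asboolP[i ij] jmax.
have om_lt k : om k j.+1 < G.
  rewrite lt_neqAle om_le andbT; apply/negP => /eqP kG.
  by have := jmax j.+1; rewrite ltnn => /(_ _)/notF[]; apply/asboolP; exists k.
have th0 : 0 < r ^+ i.
  rewrite lt_def exprn_ge0 // andbT; apply/eqP => ri.
  by move: G0; rewrite -ij /om ri mulr0 ltxx.
pose A := p%:R^-1 * G / r ^+ i.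
have A0 : 0 < A by rewrite divr_gt0 // mulr_gt0.
have gi : lambda alpha g`_i <= G / r ^+ i by rewrite ler_pdivlMr // coef_gauss.
have [w [piE w1]] := pi_decomp; have [w2 wE] := witt_decomp_mulp pR perfR w.
pose g' := if i is k.+1 then g`_k else 0.
(* Coefficient i of f = T c + g (X - pi), with pi = [pi_0] + p [pi_1] + p^2 w2, solved for the term
   in p [pi_1]; g' is the coefficient i - 1 of g. *)
have E : p%:R * (teich (tcoord pi 1) * g`_i) =
   teich c`_i + g' - f`_i - teich (tcoord pi 0) * g`_i - p%:R ^+ 2 * w2 * g`_i.
  have -> : f`_i = teich c`_i + (g' - g`_i * pi).
    by rewrite fE coefD coef_teich_poly mulrBr coefB coefMX coefMC /g'; case: (i).
  have -> : g`_i * pi = g`_i * (teich (tcoord pi 0) + p%:R * (teich (tcoord pi 1) + p%:R * w2)).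
    by rewrite -w1 -wE -piE.
  by ring.
(* On the right, [c_i] lives in coordinate 0, maximality of j controls g' and [pi_0] g_i, f has norm
   below M, and p^2 brings an extra p^-1. *)
have low : lower A j.+1 (p%:R * (teich (tcoord pi 1) * g`_i)).
  rewrite E; apply: (lowerB A0 (lowerB A0 (lowerB A0 (lowerD A0 _ _) _) _) _).
  - split; last by rewrite tcoord_teich // (seminorm0 za) mulr0.
    by rewrite lambda_teich ler_pdivlMr //; apply: le_trans (coef_gauss r sa c i) MG.
  - move: A0 th0; rewrite /g' /A; case: (i) => [|k] A0 th0.
      by apply: lower_lt; rewrite (seminorm0 zl).
    split.
      rewrite ler_pdivlMr // exprSr mulrA mulrC.
      apply: ler_pM => //; last exact: coef_gauss.
      by rewrite mulr_ge0 ?exprn_ge0 ?(seminorm_ge0 zl).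
    rewrite ltr_pdivlMr // (exprSr r) mulrA mulrC.
    apply: (@le_lt_trans _ _ (p%:R^-1 * om k j.+1)); last by rewrite ltr_pM2l.
    by rewrite ler_wpM2r // !mulr_ge0 ?exprn_ge0 ?invr_ge0 ?(ltW (pk0 _)) ?(seminorm_ge0 za).
  - apply: lower_lt; rewrite ltr_pdivlMr //.
    exact: lt_le_trans (le_lt_trans (coef_gauss r sl f i) fM) MG.
  - split.
      rewrite /A -mulrA; apply: (submul_le sl) => //; by rewrite lambda_teich.
    rewrite tcoord_teichM // /A ltr_pdivlMr //.
    apply: (@le_lt_trans _ _ (p%:R^-1 * om i j.+1)); last by rewrite ltr_pM2l.
    rewrite /om !mulrA ler_wpM2r ?(ltW th0) // [_ * p%:R ^- _]mulrC -mulrA.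
    by rewrite ler_wpM2l ?invr_ge0 ?(ltW (pk0 _)) //; exact: (submul_le sa).
  - apply: lower_lt; rewrite -mulrA.
    apply: (@le_lt_trans _ _ (p%:R^-1 ^+ 2 * (G / r ^+ i))).
      apply: (submul_le sl); first exact: (submulX_le sl) lambda_p.
      rewrite -(mul1r (G / _)); apply: (submul_le sl) => //; exact: lambda_le1.
    rewrite /A expr2 -!mulrA gtr_pMl ?invf_lt1 ?natp_gt1 ?natp_gt0 //.
    by rewrite mulr_gt0 // divr_gt0.
(* The left side has weight exactly A at coordinate j + 1. *)
case: low => _; rewrite tcoord_mulp //= tcoord_teichM // alpha_pi1M.
rewrite /A -ij /om exprS invfM !mulrA mulfK ?ltxx ?gt_eqF //.
Qed.

Lemma quotient_gauss_teich c : H (teich_poly c).[pi] = gaussR c.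
Proof.
apply/eqP; rewrite eq_le; apply/andP; split.
  by apply: le_trans (quotient_gauss_le _ _ _ _) (gauss_teich _).
by apply: quotient_gauss_ge => f; exact: gauss_teich_le.
Qed.

Lemma quotient_gauss_lead x : 0 < H x ->
  exists c, H (x - (teich_poly c).[pi]) < H x /\ gaussR c = H x.
Proof.
move=> /quotient_gauss_approx[c cx]; exists c; split=> //.
rewrite -quotient_gauss_teich; apply: (seminorm_eq zH).
by rewrite -opprB (seminormN zH).
Qed.

(** Replacing f by the lift of its residue costs at most p^-1 M < M, so the isosceles property
    applies. This serves products of lifts, which need not be lifts. *)
Lemma quotient_gauss_eq x f : 0 < H (teich_poly (map_poly (@wres p hp R) f)).[pi] ->
  let M := H (teich_poly (map_poly (@wres p hp R) f)).[pi] in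
  H (x - f.[pi]) < M -> gauss1 f <= M -> H x = M.
Proof.
set y := _.[pi] => y0 M xf fM; apply: (seminorm_eq zH).
rewrite -(subrKA f.[pi]); apply: (seminormD_lt zH) => //.
rewrite -hornerN -hornerD; apply: le_lt_trans (quotient_gauss_le _ _ _ _) _.
apply: le_lt_trans (gauss_subres _) _.
by rewrite mulrC ltr_pdivrMr ?natp_gt0 // (le_lt_trans fM) // ltr_pMr // natp_gt1.
Qed.

Lemma quotient_gauss_power_multiplicative : power_multiplicative_seminorm H.
Proof.
split=> // x n n0; have [x0|x0] := eqVneq (H x) 0.
  rewrite x0 expr0n gtn_eqF //; apply/eqP; rewrite eq_le (seminorm_ge0 zH) andbT.
  by have := submulX_le sH n (lexx (H x)); rewrite x0 expr0n gtn_eqF.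
have {}x0 : 0 < H x by rewrite lt_def x0 (seminorm_ge0 zH).
have [c [xc cx]] := quotient_gauss_lead x0.
(* The power of T c has residue c^n, whose Gauss norm is known. *)
have E : H (teich_poly (map_poly (@wres p hp R) (teich_poly c ^+ n))).[pi] = H x ^+ n.
  rewrite rmorphXn /= wres_teich_poly quotient_gauss_teich -cx.
  by case: (gauss_power_multiplicative sa r0 alpha_pm) => _ ->.
rewrite -E; apply: quotient_gauss_eq; rewrite E ?exprn_gt0 //.
  by rewrite horner_exp; exact: submulX_near.
by apply: (submulX_le sg1); rewrite -cx; exact: gauss1_teich.
Qed.

Lemma quotient_gauss_multiplicative :
  multiplicative_seminorm alpha -> multiplicative_seminorm H.
Proof.
move=> alpha_m; split=> [//||x y].
  rewrite -[1](hornerC 1 pi) -[1%:P]/(1%:P : {poly W}).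
  have -> : 1%:P = teich_poly 1%:P :> {poly W}.
    by apply/polyP => i; rewrite coef_teich_poly !coefC; case: eqP.
  by rewrite quotient_gauss_teich gaussC //; case: alpha_m.
have [x0|x0] := eqVneq (H x) 0.
  rewrite x0 mul0r; apply/eqP; rewrite eq_le (seminorm_ge0 zH) andbT.
  by case: sH => _ _ /(_ x y); rewrite x0 mul0r.
have [y0|y0] := eqVneq (H y) 0.
  rewrite y0 mulr0; apply/eqP; rewrite eq_le (seminorm_ge0 zH) andbT.
  by case: sH => _ _ /(_ x y); rewrite y0 mulr0.
have {}x0 : 0 < H x by rewrite lt_def x0 (seminorm_ge0 zH).
have {}y0 : 0 < H y by rewrite lt_def y0 (seminorm_ge0 zH).
have [c [xc cx]] := quotient_gauss_lead x0; have [d [yd dy]] := quotient_gauss_lead y0.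
have E : H (teich_poly (map_poly (@wres p hp R) (teich_poly c * teich_poly d))).[pi] = H x * H y.
  rewrite rmorphM /= !wres_teich_poly quotient_gauss_teich -cx -dy.
  by case: (gauss_multiplicative sa r0 alpha_m) => _ _ ->.
rewrite -E; apply: quotient_gauss_eq; rewrite E ?mulr_gt0 //.
  by rewrite hornerM; exact: submul_near.
by apply: (submul_le sg1); rewrite -?cx -?dy; exact: gauss1_teich.
Qed.

(** The maximum defining [lambda] is attained, so the strict inequalities of stability survive.
    Comparing with an arbitrary M > 0 also covers the case where all coordinates have seminorm 0. *)
Lemma stable_lambda x : stable alpha x -> lambda alpha x = alpha (wres x) /\
  forall M, 0 < M -> lambda alpha x <= M -> lambda alpha (x - teich (wres x)) < M.
Proof.
have le0 : alpha (wres x) <= lambda alpha x.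
  by have := coord_lambda x 0; rewrite expr0 invr1 mul1r (wres_tcoord charR perfR).
have [i] := lambda_attained (x - teich (wres x)).
rewrite tcoord_subres // => E [x0|x0].
  have l0 : lambda alpha x = 0.
    apply/eqP; rewrite eq_le (seminorm_ge0 zl) andbT.
    by apply: lambda_le => k; rewrite x0 mulr0.
  split=> [|M M0 _]; first by rewrite l0 (wres_tcoord charR perfR) x0.
  by rewrite -E; case: (i) => [|k]; rewrite ?x0 ?(seminorm0 za) mulr0.
have lx : lambda alpha x = alpha (wres x).
  apply/eqP; rewrite eq_le le0 andbT (wres_tcoord charR perfR).
  by apply: lambda_le => -[|k]; [rewrite expr0 invr1 mul1r|apply/ltW/x0].
split=> // M M0; rewrite lx -E => xM; case: (i) => [|k]; first by rewrite (seminorm0 za) mulr0.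
by apply: lt_le_trans (x0 k.+1 _) _; rewrite // -(wres_tcoord charR perfR).
Qed.

(** Let c be the residue of f. By stability f - T c has smaller Gauss norm than c, so H f.[pi] is
    the Gauss norm of c unless the latter is 0. *)
Lemma stable_horner f : (forall i, stable alpha f`_i) ->
  forall i, r ^+ i * lambda alpha f`_i <= H f.[pi].
Proof.
move=> sf i; pose c := map_poly (@wres p hp R) f.
have ci j : lambda alpha f`_j = alpha c`_j by rewrite coef_map; have [] := stable_lambda (sf j).
apply: (@le_trans _ _ (gaussR c)); first by rewrite ci mulrC coef_gauss.
have [->|c0] := eqVneq (gaussR c) 0; first exact: (seminorm_ge0 zH).
have {}c0 : 0 < gaussR c by rewrite lt_def c0 gauss_ge0.
rewrite -(quotient_gauss_teich c).
suff -> : H f.[pi] = H (teich_poly c).[pi] by [].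
apply: (seminorm_eq zH).
rewrite quotient_gauss_teich -hornerN -hornerD.
apply: le_lt_trans (quotient_gauss_le _ _ _ _) _.
apply: gauss_lt => // j; rewrite coefB coef_teich_poly.
have [->|rj] := eqVneq (r ^+ j) 0; first by rewrite mulr0.
have {}rj : 0 < r ^+ j by rewrite lt_def rj exprn_ge0.
rewrite -ltr_pdivlMr // coef_map; have [_] := stable_lambda (sf j); apply.
  exact: divr_gt0.
by rewrite ler_pdivlMr // ci coef_gauss.
Qed.

(** Both p and [pi_0] have [lambda] at most p^-1, so convergence of a presentation implies
    convergence for [lambda]. *)
Lemma lambda_ideal2 n x : in_ideal2_pow p%:R (teich (tcoord pi 0)) n x ->
  lambda alpha x <= p%:R ^- n.
Proof.
move=> [c ->]; apply: (seminorm_sum zl) => [|i _]; first by rewrite invr_ge0 ltW.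
rewrite -(mul1r (_ ^- n)); apply: (submul_le sl); first exact: lambda_le1.
have -> : p%:R ^- n = p%:R^-1 ^+ i * p%:R^-1 ^+ (n - i) :> K.
  by rewrite -exprD subnKC -?exprVn // -ltnS.
apply: (submul_le sl); first exact: (submulX_le sl) lambda_p.
by apply: (submulX_le sl); rewrite lambda_teich.
Qed.

Lemma quotient_gauss_presentation x s : presentation pi x s ->
  (forall i, stable alpha (s i)) -> is_max (fun i => r ^+ i * lambda alpha (s i)) (H x).
Proof.
move=> xs ss.
have [M [[k kM] uM]] : exists M, is_max (fun i => r ^+ i * lambda alpha (s i)) M.
  apply: (is_max_exists (prime_gt1 hp)) => i.
  rewrite mulr_ge0 ?exprn_ge0 ?(seminorm_ge0 zl) //= -(mulr1 (_ ^- i)) -exprVn.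
  apply: ler_pM; rewrite ?exprn_ge0 ?(seminorm_ge0 zl) ?lambda_le1 //.
  by apply: lerXn2r; rewrite ?nnegrE // ltW.
have M0 : 0 <= M by rewrite -kM mulr_ge0 ?exprn_ge0 ?(seminorm_ge0 zl).
suff -> : H x = M by split=> //; exists k.
(* N exceeds k so that the truncation keeps a term of maximal weight M. *)
have near e : 0 < e -> exists2 N, (k < N)%N & H (x - (\poly_(i < N) s i).[pi]) < e.
  move=> /natp_small[n ne]; have [N hN] := xs n.
  exists (maxn N k.+1); first exact: leq_maxr.
  apply: le_lt_trans ne; rewrite horner_poly; apply: le_trans (H_lambda _) _.
  by apply: lambda_ideal2; apply: hN; exact: leq_maxl.
apply/eqP; rewrite eq_le; apply/andP; split; rewrite leNgt; apply/negP.
  move=> Mx; have [N _ xN] := near _ (le_lt_trans M0 Mx).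
  suff : H x < H x by rewrite ltxx.
  rewrite -{1}(subrK (\poly_(i < N) s i).[pi] x); apply: (seminormD_lt zH) => //.
  apply: le_lt_trans Mx; rewrite horner_poly; apply: (seminorm_sum zH) => // i _.
  apply: le_trans (uM i); rewrite mulrC; apply: (submul_le sH); last exact: H_lambda.
  exact: (submulX_le sH).
move=> xM; have [N kN xN] := near _ (le_lt_trans (seminorm_ge0 zH x) xM).
suff : M < M by rewrite ltxx.
apply: (@le_lt_trans _ _ (H (\poly_(i < N) s i).[pi])).
  rewrite -{1}kM; have -> : s k = (\poly_(i < N) s i)`_k by rewrite coef_poly kN.
  (* The zero coefficients from N on are stable by the first alternative. *)
  apply: stable_horner => i; rewrite coef_poly; case: ifP => // _; left => j.
  by rewrite tcoord_zero // (seminorm0 za).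
rewrite -(subKr x _.[pi]); exact: (seminormB_lt zH).
Qed.

End Quotient.
End Polynomials.
End WittSeminorms.

(** * Real powers of seminorms *)

Section PowerSeminorm.
Variable K : realType.
Implicit Types a b c : K.

Lemma powR_le a b c : 0 <= c -> 0 <= a -> a <= b -> a `^ c <= b `^ c.
Proof. by move=> c0 a0 ab; apply: ge0_ler_powR; rewrite // nnegrE // (le_trans a0). Qed.

Lemma powRXn a c n : 0 <= a -> (a ^+ n) `^ c = (a `^ c) ^+ n.
Proof.
move=> a0; elim: n => [|n IH]; first by rewrite !expr0 powR1.
by rewrite !exprS powRM ?exprn_ge0 // IH.
Qed.

Lemma powRVK a c : 0 <= a -> c != 0 -> (a `^ c^-1) `^ c = a.
Proof. by move=> a0 c0; rewrite -powRrM mulVf // powRr1. Qed.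

Lemma powRKV a c : 0 <= a -> c != 0 -> (a `^ c) `^ c^-1 = a.
Proof. by move=> a0 c0; rewrite -powRrM mulfV // powRr1. Qed.

Variables (A : comNzRingType) (beta : A -> K) (c : K).
Hypothesis c0 : 0 < c.

Lemma fpow_submul : submultiplicative_seminorm beta ->
  submultiplicative_seminorm (fpow beta c).
Proof.
move=> sb; have [zb b1 bM] := sb; have b0 := seminorm_ge0 zb.
split=> [||x y]; last by rewrite /fpow -powRM //; apply: powR_le; rewrite ?(ltW c0).
  split=> [x||x y]; first exact: powR_ge0.
    by rewrite /fpow (seminorm0 zb) powR0 // gt_eqF.
  rewrite /fpow le_max; case: (leP (beta x) (beta y)) => xy; apply/orP; [right|left];
    by rewrite powR_le ?(ltW c0) //; apply: (seminormB zb) => //; exact: ltW.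
by have := powR_le (ltW c0) (b0 1) b1; rewrite powR1.
Qed.

Lemma fpow_power_multiplicative : power_multiplicative_seminorm beta ->
  power_multiplicative_seminorm (fpow beta c).
Proof.
move=> [sb bX]; split=> [|x n n0]; first exact: fpow_submul.
by rewrite /fpow bX // powRXn //; case: sb => zb _ _; exact: (seminorm_ge0 zb).
Qed.

Lemma fpow_le1 : seminorm beta -> (forall x, beta x <= 1) -> forall x, fpow beta c x <= 1.
Proof.
move=> zb b1 x; have := powR_le (ltW c0) (seminorm_ge0 zb x) (b1 x).
by rewrite powR1.
Qed.

End PowerSeminorm.

(** * Passage from alpha to alpha^(1/c) *)

Section Rescaling.
Variables (p : nat) (hp : prime p) (R : comNzRingType).
Hypotheses (charR : p \in [pchar R]) (perfR : bijective (fun a : R => a ^+ p)).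
Variables (K : realType) (alpha : R -> K).
Hypothesis alpha_pm : power_multiplicative_seminorm alpha.
Hypothesis alpha_le1 : forall a, alpha a <= 1.
Variable c : K.
Hypothesis c1 : 1 <= c.
Local Notation W := (witt hp R).
Local Notation ac := (fpow alpha c^-1).
Local Notation lambdac := (@lambda K p hp R ac).
Implicit Types x : W.

Let sa : submultiplicative_seminorm alpha. Proof. by case: alpha_pm. Qed.
Let za : seminorm alpha. Proof. by case: sa. Qed.
Let c0 : 0 < c. Proof. exact: lt_le_trans c1. Qed.
Let cn0 : c != 0. Proof. by rewrite gt_eqF. Qed.
Let ic0 : 0 < c^-1. Proof. by rewrite invr_gt0. Qed.
Let ip0 : 0 < p%:R^-1 :> K. Proof. by rewrite invr_gt0 natp_gt0. Qed.
Let ac_pm : power_multiplicative_seminorm ac. Proof. exact: fpow_power_multiplicative. Qed.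
Let ac_le1 a : ac a <= 1. Proof. exact: fpow_le1. Qed.
Let slc : submultiplicative_seminorm lambdac. Proof. exact: lambda_submul. Qed.
Let zlc : seminorm lambdac. Proof. by case: slc. Qed.
Let sl : submultiplicative_seminorm (@lambda K p hp R alpha). Proof. exact: lambda_submul. Qed.
Let zl : seminorm (@lambda K p hp R alpha). Proof. by case: sl. Qed.

(** Raising to the power c undoes the 1/c on alpha and turns the weights p^-i into p^(-c i). *)
Lemma coord_fpow_lambda x i :
  (p%:R^-1 `^ c) ^+ i * alpha (tcoord x i) <= fpow lambdac c x.
Proof.
have -> : (p%:R^-1 `^ c) ^+ i * alpha (tcoord x i) = (p%:R ^- i * ac (tcoord x i)) `^ c.
  rewrite powRM ?invr_ge0 ?exprn_ge0 ?powR_ge0 // -exprVn powRXn ?(ltW ip0) //.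
  by rewrite powRVK ?(seminorm_ge0 za).
apply: powR_le; rewrite ?(ltW c0) ?mulr_ge0 ?invr_ge0 ?exprn_ge0 ?powR_ge0 //.
exact: coord_lambda.
Qed.

(** Since c >= 1, p^-i is at most its power of exponent 1/c. *)
Lemma fpow_lambda_le : bounded_by (fpow lambdac c) (@lambda K p hp R alpha).
Proof.
move=> x; rewrite -[leRHS](powRVK _ cn0) ?(seminorm_ge0 zl) //.
apply: powR_le; rewrite ?(ltW c0) ?(seminorm_ge0 zlc) //; apply: lambda_le => // i.
have pi01 : 0 < (p%:R ^- i : K) <= 1.
  by rewrite invr_gt0 exprn_gt0 ?natp_gt0 //= invf_le1 ?exprn_gt0 ?natp_gt0 ?exprn_ege1 ?natp_ge1.
apply: le_trans (_ : (p%:R ^- i * alpha (tcoord x i)) `^ c^-1 <= _); last first.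
  apply: powR_le; last exact: coord_lambda; first exact: ltW.
  by rewrite mulr_ge0 ?invr_ge0 ?exprn_ge0 ?(seminorm_ge0 za).
rewrite powRM ?(seminorm_ge0 za) ?invr_ge0 ?exprn_ge0 //.
apply: ler_wpM2r; first exact: powR_ge0.
by apply: ger1_powR => //; rewrite invf_le1.
Qed.

Variables (pi : W) (r : K).
Hypothesis pi0_le : alpha (tcoord pi 0) <= p%:R^-1 `^ c.
Hypothesis pi1_unit : exists u : R, tcoord pi 1 * u = 1.
Hypotheses (r0 : 0 <= r) (r_le : r <= p%:R^-1 `^ c).
Local Notation H := (quotient_gauss (@lambda K p hp R alpha) r pi).

Let pi0_le_p : alpha (tcoord pi 0) <= p%:R^-1.
Proof.
apply: le_trans pi0_le _; apply: ge1r_powR => //.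
by rewrite ip0 invf_le1 ?natp_gt0 ?natp_ge1.
Qed.

Let sH : submultiplicative_seminorm H. Proof. exact: quotient_gauss_submul. Qed.
Let zH : seminorm H. Proof. by case: sH. Qed.

(** Both r and alpha(pi_0) are at most p^-c, hence so is H p, and the Teichmuller expansion gives
    the bound. *)
Lemma quotient_gauss_le_fpow : bounded_by H (fpow lambdac c).
Proof.
move=> x; apply: (expansion_le charR perfR alpha_pm alpha_le1 (m := p%:R^-1 `^ c)) sH _ _ _ _.
- exact: quotient_gauss_bounded.
- apply: (@le_trans _ _ (Num.max r (alpha (tcoord pi 0)))); first exact: quotient_gauss_p.
  by rewrite ge_max r_le.
- exact: powR_ge0.
- exact: coord_fpow_lambda.
Qed.

(** The converse bound follows from maximality of H, since the right side is at most [lambda] and at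
    most p^-c = r at pi. *)
Lemma quotient_gauss_fpow_lambda : r = p%:R^-1 `^ c -> H = fpow lambdac c.
Proof.
move=> rE; apply/funext => x; apply/eqP; rewrite eq_le quotient_gauss_le_fpow /=.
have sf : submultiplicative_seminorm (fpow lambdac c) by exact: fpow_submul.
apply: quotient_gauss_universal => // [|y i]; first by case: sf.
apply: (submul_le sf); first exact: fpow_lambda_le.
apply: (submulX_le sf); rewrite rE; apply: powR_le; rewrite ?(ltW c0) ?(seminorm_ge0 zlc) //.
apply: lambda_pi => //; rewrite -[leRHS](powRKV _ cn0) ?(ltW ip0) //.
by apply: powR_le; rewrite ?(ltW ic0) ?(seminorm_ge0 za).
Qed.

(** Maximality is used on both sides: for H^(1/c) through [quotient_gauss_le_fpow], and for the c-th
    power of the rescaled seminorm through [fpow_lambda_le]. *)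
Lemma quotient_gauss_rescale :
  H = fpow (quotient_gauss lambdac (r `^ c^-1) pi) c.
Proof.
have rc0 : 0 <= r `^ c^-1 by exact: powR_ge0.
have sHc : submultiplicative_seminorm (quotient_gauss lambdac (r `^ c^-1) pi).
  exact: quotient_gauss_submul.
have zHc : seminorm (quotient_gauss lambdac (r `^ c^-1) pi) by case: sHc.
apply/funext => x; apply/eqP; rewrite eq_le; apply/andP; split.
  rewrite -[leLHS](powRVK _ cn0) ?(seminorm_ge0 zH) //.
  apply: powR_le; rewrite ?(ltW c0) ?powR_ge0 //.
  have sf : submultiplicative_seminorm (fpow H c^-1) by exact: fpow_submul.
  rewrite -/(fpow H c^-1 x).
  apply: quotient_gauss_universal => // [|y i]; first by case: sf.
  apply: (submul_le sf).
    rewrite -[leRHS](powRKV _ cn0) ?(seminorm_ge0 zlc) //.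
    apply: powR_le; rewrite ?(ltW ic0) ?(seminorm_ge0 zH) //.
    exact: quotient_gauss_le_fpow.
  apply: (submulX_le sf); apply: powR_le; rewrite ?(ltW ic0) ?(seminorm_ge0 zH) //.
  exact: quotient_gauss_root.
have sf : submultiplicative_seminorm (fpow (quotient_gauss lambdac (r `^ c^-1) pi) c).
  exact: fpow_submul.
apply: quotient_gauss_universal => // [|y i]; first by case: sf.
apply: (submul_le sf).
  apply: le_trans (fpow_lambda_le y); apply: powR_le; rewrite ?(ltW c0) ?(seminorm_ge0 zHc) //.
  exact: quotient_gauss_bounded.
apply: (submulX_le sf); rewrite -[leRHS](powRVK _ cn0) //.
apply: powR_le; rewrite ?(ltW c0) ?(seminorm_ge0 zHc) //.
exact: quotient_gauss_root.
Qed.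

End Rescaling.

(** * Logarithmic exponents and the proof of the theorem *)

Lemma powR_invE (K : realType) (a c : K) : 0 < a -> a^-1 `^ c = sequences.expR (- (c * ln a)).
Proof. by move=> a0; rewrite /powR invr_eq0 gt_eqF // lnV ?posrE // mulrN. Qed.

(** Identifies c = 1 - log_b t as the exponent for which b^-c is the Gauss radius t / b. *)
Lemma powR_logb (K : realType) (b t : K) : 1 < b -> 0 < t ->
  b^-1 `^ (1 - logb b t) = t / b.
Proof.
move=> b1 t0; have b0 : 0 < b := lt_trans ltr01 b1.
rewrite powR_invE // mulrBl mul1r /logb divfK ?gt_eqF ?ln_gt0 // opprB expRD expRN.
by rewrite !lnK ?posrE.
Qed.

Lemma logb_le0 (K : realType) (b t : K) : 1 < b -> t <= 1 -> 1 <= 1 - logb b t.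
Proof.
move=> b1 t1; rewrite lerBrDr gerDl /logb pmulr_lle0 ?invr_gt0 ?ln_gt0 //.
exact: ln_le0.
Qed.

Theorem theorem5p11 (K : realType) (p : nat) (hp : prime p)
  (R : comNzRingType) (charR : p \in [pchar R])
  (perfR : bijective (fun a : R => a ^+ p))
  (alpha : R -> K)
  (alpha_pm : power_multiplicative_seminorm alpha)
  (alpha_bd : bounded_by alpha (@trivial_norm K R))
  (pi : witt hp R)
  (pi0_le : alpha (tcoord pi 0) <= p%:R^-1)
  (pi1_unit : exists u : R, tcoord pi 1 * u = 1)
  (t : K) (t_ge0 : 0 <= t) (t_le1 : t <= 1) :
  (* (a) *)
  [/\ power_multiplicative_seminorm (Hseminorm alpha pi t),
      multiplicative_seminorm alpha ->
        multiplicative_seminorm (Hseminorm alpha pi t)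
    & bounded_by (Hseminorm alpha pi t) (lambda alpha)] /\
  (* (b) *)
  (separated_complete alpha ->
   forall (x : witt hp R) (s : nat -> witt hp R),
     presentation pi x s -> (forall i, stable alpha (s i)) ->
     is_max (fun i => (t / p%:R) ^+ i * lambda alpha (s i))
            (Hseminorm alpha pi t x)) /\
  (* (c) *)
  (0 < p%:R * alpha (tcoord pi 0) -> t <= p%:R * alpha (tcoord pi 0) ->
   forall c : K, 1 <= c -> c <= 1 - logb p%:R (p%:R * alpha (tcoord pi 0)) ->
     Hseminorm alpha pi t =
     fpow (Hseminorm (fpow alpha c^-1) pi (p%:R * (t / p%:R) `^ c^-1)) c) /\
  (* (d) *)
  [/\ p%:R * alpha (tcoord pi 0) <= t -> 0 < t ->
        let c := 1 - logb p%:R t in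
        Hseminorm alpha pi t = fpow (lambda (fpow alpha c^-1)) c,
      Hseminorm alpha pi 1 = lambda alpha
    & p%:R * alpha (tcoord pi 0) <= t -> t = 0 ->
        Hseminorm alpha pi t = alpha \o @wres p hp R].
Proof.
have [sa _] := alpha_pm; have [za _ _] := sa.
have alpha_le1 a : alpha a <= 1.
  by apply: le_trans (alpha_bd a) _; rewrite /trivial_norm; case: eqP.
have p0 : 0 < p%:R :> K by exact: natp_gt0.
have p1 : 1 < p%:R :> K by exact: natp_gt1.
have r0 : 0 <= t / p%:R by rewrite divr_ge0 // ltW.
have r_le : t / p%:R <= p%:R^-1 by rewrite ler_pdivrMr // mulVf ?gt_eqF.
have sl := lambda_submul hp charR perfR alpha_pm alpha_le1.
(* Stated for any u, as it is used both at t and at 1; for u = 1 the exponent c is 1. *)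
have main_d u : p%:R * alpha (tcoord pi 0) <= u -> 0 < u -> u <= 1 ->
    Hseminorm alpha pi u = fpow (lambda (fpow alpha (1 - logb p%:R u)^-1)) (1 - logb p%:R u).
  move=> pu u0 u1; have uE := powR_logb p1 u0.
  apply: quotient_gauss_fpow_lambda; rewrite ?uE ?logb_le0 ?divr_ge0 ?(ltW u0) ?(ltW p0) //.
  by rewrite ler_pdivlMr // mulrC.
split; [split|split; [|split; [|split]]].
- exact: quotient_gauss_power_multiplicative.
- exact: quotient_gauss_multiplicative.
- exact: quotient_gauss_bounded.
- by move=> _ x s; exact: quotient_gauss_presentation.
- move=> s0 ts c c1 cs; have {}s0 : 0 < alpha (tcoord pi 0) by rewrite -(pmulr_rgt0 _ p0).
  (* The upper bound on c, in exponential form. *)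
  have sc : alpha (tcoord pi 0) <= p%:R^-1 `^ c.
    have -> : alpha (tcoord pi 0) = p%:R * alpha (tcoord pi 0) / p%:R.
      by rewrite mulrAC mulfV ?mul1r ?gt_eqF.
    rewrite -powR_logb ?mulr_gt0 // !powR_invE // ler_expR lerN2.
    by rewrite ler_wpM2r // ln_ge0 // ltW.
  (* Dividing p (t/p)^(1/c) by p leaves the radius (t/p)^(1/c). *)
  rewrite /Hseminorm (mulrC p%:R) mulfK ?gt_eqF //.
  apply: quotient_gauss_rescale => //.
  by apply: le_trans sc; rewrite ler_pdivrMr // mulrC.
- by move=> st t0; exact: main_d.
- rewrite main_d //; last by rewrite -ler_pdivlMl // mulr1.
  rewrite /logb ln1 mul0r subr0 invr1.
  have f1 (T : Type) (f : T -> K) : (forall x, 0 <= f x) -> fpow f 1 = f.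
    by move=> f0; apply/funext => x; rewrite /fpow powRr1.
  have [zl _ _] := sl; rewrite (f1 _ alpha); last exact: seminorm_ge0 za.
  by apply: f1; exact: seminorm_ge0 zl.
move=> st t0; rewrite {}t0 in st r0 r_le *.
have s0 : alpha (tcoord pi 0) = 0.
  by apply/eqP; rewrite eq_le (seminorm_ge0 za) andbT -(pmulr_rle0 _ p0).
apply/funext => x; apply/eqP; rewrite eq_le; apply/andP; split => /=.
  (* Here t and alpha(pi_0) vanish, so H p = 0; as 0^0 = 1, only coordinate 0 counts. *)
  apply: (expansion_le charR perfR alpha_pm alpha_le1 (m := 0)).
  - exact: quotient_gauss_submul.
  - exact: quotient_gauss_bounded.
  - apply: (@le_trans _ _ (Num.max (0 / p%:R) (alpha (tcoord pi 0)))).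
      exact: quotient_gauss_p.
    by rewrite s0 mul0r maxxx.
  - exact: seminorm_ge0.
  - move=> [|i]; first by rewrite expr0 mul1r (wres_tcoord charR perfR).
    by rewrite expr0n mul0r (seminorm_ge0 za).
rewrite -[alpha _]/((alpha \o @wres p hp R) x).
(* Conversely, alpha of the residue is bounded by [lambda] and vanishes at pi, as radius 0
   demands. *)
apply: quotient_gauss_universal => // [|y i].
  split=> [y||y z]; rewrite /comp; first exact: (seminorm_ge0 za).
    by rewrite rmorph0 (seminorm0 za).
  by rewrite rmorphB; case: za.
rewrite /comp rmorphM rmorphXn; apply: (submul_le sa).
  have := coord_lambda alpha_le1 y 0.
  by rewrite expr0 invr1 mul1r -(wres_tcoord charR perfR).
by apply: (submulX_le sa); rewrite mul0r -s0 -(wres_tcoord charR perfR).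
Qed.
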